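(* For each countable ordinal $\alpha \geq 2$ there exists a $\sigma$-compact separable metrizable space $Z$ which has the transfinite dimension $\mathrm{ind}$ (and if $\alpha$ is finite, so is $\mathrm{ind}\, Z$), such that every image of $Z$ under a non-constant closed mapping contains a compact set whose transfinite dimension $\mathrm{ind}$ is either $\geq \alpha$ or is not defined.
   Context: All spaces (including the images of mappings) are separable and metrizable. A closed mapping is a continuous map sending closed sets to closed sets. A space is $\sigma$-compact if it is a countable union of compact sets. The transfinite small inductive dimension $\mathrm{ind}$ is the extension of the Menger-Urysohn dimension by transfinite induction: $\mathrm{ind}\, X = -1$ iff $X = \emptyset$; for an ordinal $\alpha \geq 0$, $\mathrm{ind}\, X \leq \alpha$ if for every $x \in X$ and every open $V \ni x$ there is an open $U$ with $x \in U \subseteq V$ and $\mathrm{ind}\,(\mathrm{Fr}\, U) \leq \beta$ for some $\beta < \alpha$, where $\beta$ is $-1$ or an ordinal and $\mathrm{Fr}\, U$ is the boundary of $U$. If $\mathrm{ind}\, X \leq \alpha$ for some ordinal $\alpha$, then $\mathrm{ind}\, X$ is the least such value and one says that $X$ has the transfinite dimension $\mathrm{ind}$; otherwise $\mathrm{ind}\, X$ is not defined. *)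

(* Defs.v *)
From HB Require Import structures.
From mathcomp Require Import all_boot all_order all_algebra wochoice.
From mathcomp Require Import all_classical reals topology.

Set Implicit Arguments.
Unset Strict Implicit.
Unset Printing Implicit Defensive.

Local Open Scope classical_set_scope.

(** Ordinals are represented by well-ordered types (so [a] stands for its order
    type, and its elements for the ordinals below it).  Two representatives of
    the same ordinal are isomorphic rather than equal, hence ordinals are only
    ever compared with [ord_le]. *)
Record ordnum := OrdNum {
  ord_sort :> Type;
  ord_rel : rel ord_sort;
  ord_wo : well_order ord_rel }.

(* isomorphic to an initial segment *)
Definition ord_le (a b : ordnum) : Prop :=
  exists f : a -> b,
    (forall x y, ord_rel (f x) (f y) = ord_rel x y) /\
    (forall x z, ord_rel z (f x) -> range f z).

Lemma well_order_ord n : well_order (fun i j : 'I_n => (i <= j)%N).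
Proof.
apply: antisymmetric_well_order => [i j /anti_leq/val_inj //|A [i0 Ai0]].
case: (arg_minnP (fun i : 'I_n => i : nat) Ai0) => i Ai imin.
by exists i; split.
Qed.

Definition ord_of_nat (n : nat) : ordnum := OrdNum (@well_order_ord n).

Definition ord_countable (a : ordnum) : Prop := countable [set: a].
Definition ord_finite (a : ordnum) : Prop := finite_set [set: a].

(** Values of the dimension: [None] is -1 and [Some a] is the ordinal [a]. *)
Definition dim_le (d e : option ordnum) : Prop :=
  match d, e with
  | None, _ => True
  | Some _, None => False
  | Some a, Some b => ord_le a b
  end.

Definition dim_lt (d e : option ordnum) : Prop := dim_le d e /\ ~ dim_le e d.

Definition frontier (T : topologicalType) (A : set T) : set T :=
  closure A `\` A°.

(** [ind_le X d] is "ind X <= d".  The frontier of [U], being a [set X], is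
    coerced to a type, which carries the subspace topology.  The
    least-fixed-point reading agrees with the recursive one because the order
    on ordinals is well-founded. *)
Inductive ind_le : topologicalType -> option ordnum -> Prop :=
| ind_le_empty (X : topologicalType) :
    [set: X] = set0 -> ind_le X None
| ind_le_ord (X : topologicalType) (a : ordnum) :
    (forall (x : X) (V : set X), open V -> V x ->
       exists (U : set X) (d : option ordnum),
         [/\ open U, U x, U `<=` V, dim_lt d (Some a)
           & ind_le (frontier U : Type) d]) ->
    ind_le X (Some a).

Definition ind_eq (X : topologicalType) (d : option ordnum) : Prop :=
  ind_le X d /\ forall e, ind_le X e -> dim_le d e.

Definition has_ind (X : topologicalType) : Prop :=
  exists a : ordnum, ind_le X (Some a).

Definition separable (T : topologicalType) : Prop :=
  exists2 D : set T, countable D & dense D.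

Definition sigma_compact (T : topologicalType) : Prop :=
  exists2 K : nat -> set T, forall n, compact (K n) & \bigcup_n K n = [set: T].

Definition closed_mapping (S T : topologicalType) (f : S -> T) : Prop :=
  continuous f /\ forall F : set S, closed F -> closed (f @` F).

Definition non_constant (S T : Type) (f : S -> T) : Prop :=
  exists x y : S, f x <> f y.

(* Main.v *)
Require Import Defs.
From HB Require Import structures.
From mathcomp Require Import all_boot all_order all_algebra wochoice.
From mathcomp Require Import all_classical reals topology.
From mathcomp Require Import zify ring lra.

(** The points of [Z] are finitely supported maps on [nat * nat] with values in
    [0, 1], where the second index counts the coordinates inside a block and two
    coordinates may be irrational simultaneously only if their blocks are joined
    in a graph [C] without infinite cliques.  The boundary of a generic small box
    uses up one block, so ind [Z] is bounded by the rank of the tree of cliques.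

    Given a closed map [f], points that escape to infinity inside one block form
    a closed discrete set; this makes the fibres of [f] nowhere dense and lets one
    choose, block after block, an edge [0, d] on a coordinate far enough that [f]
    separates the opposite faces of the compact union [L] of all the cubes spanned
    by the edges of a clique.  By the Poincare-Miranda theorem the images of the
    faces are pairs of closed sets that are essential along every clique.

    If ind of [f L] were an ordinal below [alpha], iterating partitions with
    boundaries of smaller ind would show that the pairs of some clique are
    inessential.  For finite [alpha] the complete graph on [alpha] works, thanks
    to a finite sum theorem.  For infinite [alpha] there is none, and the blocks
    are descending sequences in [alpha * nat]: at each stage, with finitely many
    pieces left, every piece gets a pair of its own. *)

Set Implicit Arguments.
Unset Strict Implicit.
Unset Printing Implicit Defensive.

Import Order.TTheory GRing.Theory Num.Theory.
Import numFieldTopology.Exports.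

Local Open Scope classical_set_scope.
Local Open Scope ring_scope.

(** * Ordinals and transfinite dimension *)

(** The graph serves two opposite ends: its cliques must be well-founded enough to make ind [Z] an
    ordinal, and plentiful enough that every compact set of ind below [alpha] makes some clique
    inessential. The rest of the construction answers the fact that [f] is unknown when [Z] is
    built. A block has infinitely many coordinates so that an edge can be moved out of reach of
    whatever was fixed before. Closedness of [f] enters only through escaping sequences: their range
    is closed, so their images cannot approach a point that they avoid. To use this at a limit point
    [y], the sequence must be pushed off the fibre of [y], which is why fibres must be shown to have
    empty interior first. Irrationality exploits that the rationals are countable. A point is a
    finite set of freely moving coordinates plus a finite table of rationals, so countably many
    compact sets fill [Z]; and in the dimension estimate the forbidden values form a sequence,
    extended by finitely many face values at each stage, so that a radius avoiding it always
    exists. *)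

Lemma ord_min (a : ordnum) (P : a -> Prop) : (exists x, P x) ->
  exists x, P x /\ forall y, P y -> ord_rel x y.
Proof.
move=> [x0 Px0]; have [|x [[Px xmin] _]] := @ord_wo a (fun x => `[< P x >]).
  by exists x0; apply/asboolP.
exists x; split; first exact/asboolP.
by move=> y Py; apply: xmin; apply/asboolP.
Qed.

Lemma ord_refl (a : ordnum) (x : a) : ord_rel x x.
Proof. by have [|y [-> ]] := @ord_min a (fun y => y = x); [exists x|exact]. Qed.

Lemma ord_total (a : ordnum) (x y : a) : ord_rel x y \/ ord_rel y x.
Proof.
have [|z [[->|->] zmin]] := @ord_min a (fun z => z = x \/ z = y).
- by exists x; left.
- by left; apply: zmin; right.
- by right; apply: zmin; left.
Qed.

Lemma ord_antisym (a : ordnum) (x y : a) : ord_rel x y -> ord_rel y x -> x = y.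
Proof.
move=> xy yx.
have [|z [_ zuniq]] := @ord_wo a (fun z => `[< z = x \/ z = y >]).
  by exists x; apply/asboolP; left.
by transitivity z; [symmetry|]; apply: zuniq; split; try (by apply/asboolP; auto);
  move=> w /asboolP [->|->] //; exact: ord_refl.
Qed.

Lemma ord_trans (a : ordnum) (y x z : a) :
  ord_rel x y -> ord_rel y z -> ord_rel x z.
Proof.
move=> xy yz.
have [|w [wxyz wmin]] := @ord_min a (fun w => [\/ w = x, w = y | w = z]).
  by exists x; constructor.
have wx : ord_rel w x by apply: wmin; constructor.
have wy : ord_rel w y by apply: wmin; constructor.
have wz : ord_rel w z by apply: wmin; constructor.
case: wxyz => ?; subst w => //.
- by rewrite (ord_antisym xy wx).
- by rewrite -(ord_antisym yz wy).
Qed.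

Lemma ord_nle (a : ordnum) (x y : a) : ~ ord_rel x y -> ord_rel y x.
Proof. by case: (ord_total x y). Qed.

(** The strict order has no name of its own: [~ ord_rel x y] says that [y] lies below [x]. *)
Lemma ordP_ind (a : ordnum) (P : a -> Prop) :
  (forall x, (forall y, ~ ord_rel x y -> P y) -> P x) -> forall x, P x.
Proof.
move=> IH x; apply: contrapT => nPx.
have [|y [nPy ymin]] := @ord_min a (fun y => ~ P y); first by exists x.
apply: nPy; apply: IH => z nyz; apply: contrapT => nPz.
by apply: nyz; apply: ymin.
Qed.

Lemma iseg_wo (a : ordnum) (x : a) :
  well_order (fun y z : {y : a | ~~ ord_rel x y} => ord_rel (sval y) (sval z)).
Proof.
apply: antisymmetric_well_order => [y z /andP[yz zy]|A [y Ay]].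
  by apply: val_inj; apply: ord_antisym.
have [|z [[w -> Aw] zmin]] := @ord_min a (fun z => exists2 w, z = sval w & w \in A).
  by exists (sval y), y.
by exists w; split=> // v Av; apply: zmin; exists v.
Qed.

(** The ordinal for which the element [x] stands, as a type of its own, so that [Some (iseg x)] is a
    dimension value. *)
Definition iseg (a : ordnum) (x : a) : ordnum := OrdNum (@iseg_wo a x).

Lemma ord_le_refl a : ord_le a a.
Proof. by exists id; split=> // x z _; exists z. Qed.

Lemma ord_le_trans b a c : ord_le a b -> ord_le b c -> ord_le a c.
Proof.
move=> [f [fr fi]] [g [gr gi]]; exists (g \o f); split=> [x y|x z /= zle].
  by rewrite /= gr fr.
have [y _ yz] := gi _ _ zle; subst z; rewrite gr in zle.
by have [w _ wy] := fi _ _ zle; exists w => //=; rewrite wy.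
Qed.

(** Embeddings arise here as relations (equal projections, isomorphic segments). Monotonicity in
    both directions makes [E] functional, so any choice of values is an embedding. *)
Lemma ord_le_of_rel (a b : ordnum) (E : a -> b -> Prop) :
  (forall x, exists y, E x y) ->
  (forall x x' y y', E x y -> E x' y' -> ord_rel y y' = ord_rel x x') ->
  (forall x y y', E x y -> ord_rel y' y -> exists x', E x' y') ->
  ord_le a b.
Proof.
move=> /choice[f Ef] Emono Einit; exists f; split=> [x y|x z zle].
  exact: Emono.
have [w Ewz] := Einit _ _ _ (Ef x) zle; exists w => //.
apply: ord_antisym; first by rewrite (Emono _ _ _ _ (Ef w) Ewz) ord_refl.
by rewrite (Emono _ _ _ _ Ewz (Ef w)) ord_refl.
Qed.

Lemma ord_emb_ge (a : ordnum) (f : a -> a) :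
  (forall x y, ord_rel (f x) (f y) = ord_rel x y) -> forall x, ord_rel x (f x).
Proof.
move=> fr; apply: ordP_ind => x IH; apply: contrapT => nxfx.
by apply: (nxfx); rewrite -fr; apply: IH.
Qed.

Lemma iseg_le (a : ordnum) (x : a) : ord_le (iseg x) a.
Proof.
exists (fun y => sval y); split=> // -[y yx] z /= zy.
have zx : ~~ ord_rel x z by apply/negP => xz; move/negP: yx; apply; exact: ord_trans xz zy.
by exists (exist _ z zx).
Qed.

Lemma iseg_mono (a : ordnum) (x y : a) : ord_rel x y -> ord_le (iseg x) (iseg y).
Proof.
move=> xy; apply: (@ord_le_of_rel (iseg x) (iseg y) (fun u v => sval u = sval v)).
- case=> z zx; have zy : ~~ ord_rel y z.
    by apply/negP => yz; move/negP: zx; apply; exact: ord_trans xy yz.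
  by exists (exist _ z zy).
- by move=> u u' v v' /= -> ->.
- move=> [u ux] [v vx] [w wx] /= E wv; subst v.
  have wx' : ~~ ord_rel x w.
    by apply/negP => xw; move/negP: ux; apply; exact: ord_trans xw wv.
  by exists (exist _ w wx').
Qed.

(** Otherwise [y] lies below [x], and the embedding, followed by the inclusion of [iseg y], maps
    [iseg x] to itself and sends [y] strictly below itself, against [ord_emb_ge]. *)
Lemma iseg_le_inv (a : ordnum) (x y : a) : ord_le (iseg x) (iseg y) -> ord_rel x y.
Proof.
move=> [f [fr _]]; apply: contrapT => nxy; have yx := ord_nle nxy.
have sub z : ~~ ord_rel y z -> ~~ ord_rel x z.
  by move=> /negP nyz; apply/negP => /(ord_trans yx).
pose h (u : iseg x) : iseg x := exist _ (sval (f u)) (sub _ (svalP (f u))).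
have hr u v : ord_rel (h u) (h v) = ord_rel u v by exact: (fr u v).
have nb : ~~ ord_rel x y by apply/negP.
have yh := ord_emb_ge hr (exist _ y nb : iseg x).
by have /negP := svalP (f (exist _ y nb)); apply.
Qed.

Lemma iseg_iseg (a : ordnum) (x : a) (y : iseg x) :
  ord_le (iseg y) (iseg (sval y)) /\ ord_le (iseg (sval y)) (iseg y).
Proof.
split.
- apply: (@ord_le_of_rel (iseg y) (iseg (sval y)) (fun u v => sval (sval u) = sval v)).
  + by move=> [[z zx] /= zy]; exists (exist _ z zy).
  + by move=> u u' v v' /= <- <-.
  + move=> [[z zx] /= zy] [v vx] [w wy] /= _ _.
    have wx : ~~ ord_rel x w.
      apply/negP => xw; move/negP: wy; apply; apply: ord_trans xw.
      by apply: ord_nle; apply/negP; exact: (svalP y).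
    by exists (exist _ (exist _ w wx) wy).
- apply: (@ord_le_of_rel (iseg (sval y)) (iseg y) (fun v u => sval (sval u) = sval v)).
  + move=> [w wy]; have wx : ~~ ord_rel x w.
      apply/negP => xw; move/negP: wy; apply; apply: ord_trans xw.
      by apply: ord_nle; apply/negP; exact: (svalP y).
    by exists (exist _ (exist _ w wx) wy).
  + by move=> u u' v v' /= -> ->.
  + move=> [v vx] [[z zx] zy] [[w wx] wy] _ _; by exists (exist _ w wy).
Qed.

Lemma ord_lt_iseg (a b : ordnum) : ord_le a b -> ~ ord_le b a ->
  exists x : b, ord_le a (iseg x) /\ ord_le (iseg x) a.
Proof.
move=> [f [fr fi]] nba.
have [x0 nx0] : exists x, ~ range f x.
  apply: contra_notP nba => nx; apply: (@ord_le_of_rel _ _ (fun y x => f x = y)).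
  - by move=> y; apply: contrapT => nf; apply: nx; exists y => -[x _ fx]; apply: nf; exists x.
  - by move=> y y' x x' <- <-.
  - by move=> y x x' _ _; exists (f x').
have [|x [nx xmin]] := @ord_min b (fun x => ~ range f x); first by exists x0.
have fx z : ~~ ord_rel x (f z) by apply/negP => /fi.
exists x; split.
- apply: (@ord_le_of_rel a (iseg x) (fun z u => f z = sval u)).
  + by move=> z; exists (exist _ (f z) (fx z)).
  + by move=> z z' u u' /= <- <-.
  + by move=> z u u' /= fz; rewrite /= -fz => /fi [z' _ z'u]; exists z'.
- apply: (@ord_le_of_rel (iseg x) a (fun u z => f z = sval u)).
  + move=> [u ux] /=; apply: contrapT => nu; move/negP: ux; apply; apply: xmin.
    by move=> [z _ zu]; apply: nu; exists z.
  + by move=> u u' z z' /= <- <-.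
  + by move=> u z z' _ _; exists (exist _ (f z') (fx z')).
Qed.

(** * Comparability of well-orders *)

Definition seg_iso (a b : ordnum) (x : a) (y : b) :=
  ord_le (iseg x) (iseg y) /\ ord_le (iseg y) (iseg x).

Lemma seg_isoC (a b : ordnum) (x : a) (y : b) : seg_iso x y -> seg_iso y x.
Proof. by case. Qed.

Lemma seg_iso_mono (a b : ordnum) (x x' : a) (y y' : b) :
  seg_iso x y -> seg_iso x' y' -> ord_rel y y' = ord_rel x x'.
Proof.
move=> [xy yx] [xy' yx']; apply/idP/idP => le; apply: iseg_le_inv.
- by apply: (ord_le_trans xy); apply: ord_le_trans yx'; exact: iseg_mono.
- by apply: (ord_le_trans yx); apply: ord_le_trans xy'; exact: iseg_mono.
Qed.

Lemma seg_iso_down (a b : ordnum) (x : a) (y y' : b) :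
  seg_iso x y -> ord_rel y' y -> exists x' : a, seg_iso x' y'.
Proof.
move=> [xy yx] y'y; have [yy'|nyy'] := pselect (ord_rel y y').
  by exists x; rewrite (ord_antisym y'y yy').
have le : ord_le (iseg y') (iseg x) by apply: ord_le_trans yx; apply: iseg_mono.
have [|z [le1 le2]] := ord_lt_iseg le.
  by move=> le'; apply: nyy'; apply: iseg_le_inv; exact: ord_le_trans yx le'.
have [zz1 zz2] := iseg_iseg z; exists (sval z); split.
- exact: ord_le_trans zz2 le2.
- exact: ord_le_trans le1 zz1.
Qed.

Lemma seg_iso_limit (a b : ordnum) (x : a) (y : b) :
  (forall z, ~~ ord_rel x z -> exists w : b, seg_iso z w) ->
  (forall z : a, ~ seg_iso z y) -> ord_le (iseg x) (iseg y).
Proof.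
move=> D ny; apply: (@ord_le_of_rel (iseg x) (iseg y) (fun u v => seg_iso (sval u) (sval v))).
- move=> [z zx]; have [w zw] := D z zx.
  have wy : ~~ ord_rel y w.
    by apply/negP => yw; have [z' /ny] := seg_iso_down zw yw.
  by exists (exist _ w wy).
- by move=> u u' v v'; exact: seg_iso_mono.
- move=> [z zx] [w wy] [w' w'y] /= zw w'w; have [z' z'w'] := seg_iso_down zw w'w.
  have z'x : ~~ ord_rel x z'.
    apply/negP => xz'; move/negP: zx; apply; apply: ord_trans xz' _.
    by rewrite -(seg_iso_mono z'w' zw).
  by exists (exist _ z' z'x).
Qed.

(** If both sides have elements without partner, the predecessors of the least such [x] and [y] all
    have partners. By [seg_iso_limit] the two segments embed into each other, so [x] and [y] are
    partners after all. *)
Lemma ord_le_total (a b : ordnum) : ord_le a b \/ ord_le b a.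
Proof.
have [D|/existsNP[x0 nx0]] := pselect (forall x : a, exists y : b, seg_iso x y).
  left; apply: (ord_le_of_rel D); first by move=> *; exact: seg_iso_mono.
  by move=> x y y'; exact: seg_iso_down.
have [D|/existsNP[y0 ny0]] := pselect (forall y : b, exists x : a, seg_iso y x).
  right; apply: (ord_le_of_rel D); first by move=> *; exact: seg_iso_mono.
  by move=> x y y'; exact: seg_iso_down.
have [|x [nx xmin]] := @ord_min a (fun x => ~ exists y : b, seg_iso x y).
  by exists x0.
have [|y [ny ymin]] := @ord_min b (fun y => ~ exists x : a, seg_iso y x).
  by exists y0.
case: (nx); exists y; split; apply: seg_iso_limit.
- move=> z /negP nxz; apply: contrapT => nz; apply: nxz; exact: xmin.
- by move=> z /seg_isoC zy; apply: ny; exists z.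
- move=> z /negP nxz; apply: contrapT => nz; apply: nxz; exact: ymin.
- by move=> z /seg_isoC xz; apply: nx; exists z.
Qed.

Lemma dim_le_trans e d d' : dim_le d e -> dim_le e d' -> dim_le d d'.
Proof. by case: d e d' => [a|] [b|] [c|] //=; exact: ord_le_trans. Qed.

Lemma dim_lt_le_trans e d d' : dim_lt d e -> dim_le e d' -> dim_lt d d'.
Proof.
move=> [de ned] ed'; split; first exact: dim_le_trans de ed'.
by move=> /(dim_le_trans ed').
Qed.

Lemma dim_lt_iseg (a : ordnum) (x y : a) : ~ ord_rel x y ->
  dim_lt (Some (iseg y)) (Some (iseg x)).
Proof.
move=> nxy; split=> /=; first exact/iseg_mono/ord_nle.
by move=> /iseg_le_inv.
Qed.

Lemma dim_lt_isegP (a : ordnum) (x : a) d : dim_lt d (Some (iseg x)) ->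
  d = None \/ exists2 y, ~ ord_rel x y & dim_le d (Some (iseg y)).
Proof.
case: d => [b|]; [|by left]; move=> [/= le nle]; right.
have [y [le1 le2]] := ord_lt_iseg le nle; have [yy1 yy2] := iseg_iseg y.
exists (sval y); first exact/negP/(svalP y).
exact: ord_le_trans le1 yy1.
Qed.

Lemma ind_le_None (X : topologicalType) : ind_le X None -> [set: X] = set0.
Proof. by move E : None => d H; case: H E. Qed.

Lemma ind_le_Some (X : topologicalType) (a : ordnum) : ind_le X (Some a) ->
  forall (x : X) (V : set X), open V -> V x ->
    exists (U : set X) (d : option ordnum),
      [/\ open U, U x, U `<=` V, dim_lt d (Some a)
        & ind_le (frontier U : Type) d].
Proof. by move E : (Some a) => d H; case: H E => // X' b H' [->]. Qed.

Lemma ind_le_mono (X : topologicalType) d e : ind_le X d -> dim_le d e -> ind_le X e.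
Proof.
case: e => [b|]; last by case: d.
move=> Xd de; apply: ind_le_ord => x V oV Vx; case: d Xd de => [a|] Xd de.
  have [U [d [oU Ux UV da Fd]]] := ind_le_Some Xd oV Vx.
  by exists U, d; split=> //; exact: dim_lt_le_trans da de.
by have := ind_le_None Xd; rewrite -subset0 => /(_ x I).
Qed.

Lemma ind_eq_exists (X : topologicalType) (a : ordnum) : ind_le X (Some a) ->
  exists2 d, ind_eq X d & dim_le d (Some a).
Proof.
move=> Xa; have [X0|X0] := pselect ([set: X] = set0).
  by exists None => //; split; [exact: ind_le_empty|].
have [b [ba Xb bmin]] : exists b : ordnum, [/\ ord_le b a, ind_le X (Some b) &
    forall x : b, ~ ind_le X (Some (iseg x))].
  have [ex|nex] := pselect (exists x : a, ind_le X (Some (iseg x))).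
    have [x [Xx xmin]] := ord_min ex; exists (iseg x); split=> // [|y Xy].
      exact: iseg_le.
    have /negP := svalP y; apply; apply: xmin.
    by apply: (ind_le_mono Xy); case: (iseg_iseg y).
  exists a; split=> // [|x Xx]; first exact: ord_le_refl.
  by apply: nex; exists x.
exists (Some b) => //; split=> // -[e|] Xe; last by case: X0; exact: ind_le_None.
have [//|eb] := ord_le_total b e; apply: contrapT => nbe.
have [x [ex xe]] := ord_lt_iseg eb nbe.
by apply: (bmin x); exact: (ind_le_mono (e := Some (iseg x)) Xe ex).
Qed.

(** Comparability turns the absence of a bound below [a] into the alternative. The element [x0]
    excludes the value -1, since [iseg x0] bounds the dimension of an empty space. *)
Lemma ind_ge_or_undefined (X : topologicalType) (a : ordnum) (x0 : a) :
  (forall x : a, ~ ind_le X (Some (iseg x))) ->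
  (exists2 d, ind_eq X d & dim_le (Some a) d) \/ ~ has_ind X.
Proof.
move=> nX; have [[b Xb]|nind] := pselect (has_ind X); [left|by right].
have [d Xd db] := ind_eq_exists Xb; exists d => //.
case: d Xd db => [c|] [Xc _] _ /=; last first.
  by apply: (nX x0); exact: (ind_le_mono Xc).
have [//|ca] := ord_le_total a c; apply: contrapT => nac.
have [x [cx xc]] := ord_lt_iseg ca nac.
by apply: (nX x); exact: (ind_le_mono (e := Some (iseg x)) Xc cx).
Qed.

(** * A discrete Poincare-Miranda theorem *)

Local Close Scope classical_set_scope.

Definition pt_step (I : eqType) (a : I) (x : I -> nat) : I -> nat :=
  fun i => (x i + (i == a))%N.

Definition pt_set (I : eqType) (a : I) (t : nat) (x : I -> nat) : I -> nat :=
  fun i => if i == a then t else x i.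

Lemma pt_stepC (I : eqType) (a b : I) x :
  pt_step a (pt_step b x) = pt_step b (pt_step a x).
Proof. by apply: funext => i; rewrite /pt_step addnAC. Qed.

Lemma pt_step_set (I : eqType) (a b : I) t x : a != b ->
  pt_step a (pt_set b t x) = pt_set b t (pt_step a x).
Proof.
move=> /negPf ab; apply: funext => i; rewrite /pt_step /pt_set.
by case: (eqVneq i b) => // ->; rewrite eq_sym ab addn0.
Qed.

Lemma pt_step_set_same (I : eqType) (a : I) t x :
  pt_step a (pt_set a t x) = pt_set a t.+1 x.
Proof.
apply: funext => i; rewrite /pt_step /pt_set.
by case: (i == a); rewrite ?addn1 ?addn0.
Qed.

Lemma pt_setC (I : eqType) (a b : I) s t x : a != b ->
  pt_set a s (pt_set b t x) = pt_set b t (pt_set a s x).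
Proof.
move=> ab; apply: funext => i; rewrite /pt_set.
by case: (eqVneq i a) => // ->; rewrite (negPf ab).
Qed.

Lemma addbb_ring (b : bool) : b + b = 0. Proof. by case: b. Qed.

Lemma sum_swap_pairs (I : finType) (A : {set I}) (g : I -> I -> bool) :
  \sum_(a in A) \sum_(b in A :\ a) g a b = \sum_(a in A) \sum_(b in A :\ a) g b a.
Proof.
rewrite (exchange_big_dep (mem A)) /=; last by move=> a b _ /setD1P[].
apply: eq_bigr => b bA; apply: eq_bigl => a; rewrite !inE bA eq_sym.
by case: (a \in A) => /=; rewrite ?andbT ?andbF.
Qed.

(** Addition in [bool] is exclusive or, so the terms of (a, b) and (b, a) cancel. *)
Lemma sum_sym_pairs (I : finType) (A : {set I}) (g : I -> I -> bool) :
  (forall a b, g a b = g b a) -> \sum_(a in A) \sum_(b in A :\ a) g a b = 0.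
Proof.
move=> gC.
transitivity (\sum_(a in A) (\sum_(b in A | (enum_rank b < enum_rank a)%N) g a b
    + \sum_(b in A | (enum_rank a < enum_rank b)%N) g a b)).
  apply: eq_bigr => a aA; rewrite (bigID (fun b => enum_rank b < enum_rank a)%N) /=.
  congr (_ + _); apply: eq_bigl => b; rewrite !inE -(inj_eq enum_rank_inj) -val_eqE /=;
    by case: (b \in A); case: ltngtP.
rewrite big_split /=.
rewrite [X in _ + X](exchange_big_dep (mem A)) /=; last by move=> a b _ /andP[].
rewrite -big_split big1 //= => a aA.
rewrite [X in _ + X](eq_bigr (fun b => g a b)) ?addbb_ring//.
rewrite [X in _ + X](eq_bigl (fun b => (b \in A) && (enum_rank b < enum_rank a)%N)) ?addbb_ring //.
by move=> b; rewrite aA.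
Qed.

(* The cup product of the mod 2 coboundaries of the labels [lab j], [j \in S],
   evaluated on the cell at [x] with edge directions [A]. *)
Fixpoint cup_form (I : finType) (lab : I -> (I -> nat) -> bool) (S : seq I)
    (A : {set I}) (x : I -> nat) : bool :=
  if S is j :: S' then
    \sum_(a in A) (lab j (pt_step a x) + lab j x) * cup_form lab S' (A :\ a) (pt_step a x)
  else A == finset.set0.

(** A cup product of coboundaries is a cocycle. Expanding the first factor gives double sums over
    two removed directions; those symmetric in the directions cancel, the others vanish by induction
    at [x] and at its neighbours. *)
Lemma cup_form_closed (I : finType) lab (S : seq I) (A : {set I}) x :
  \sum_(a in A) (cup_form lab S (A :\ a) (pt_step a x) + cup_form lab S (A :\ a) x) = 0.
Proof.
elim: S A x => [|j S IH] A x /=; first by rewrite big1 // => a _; rewrite addbb_ring.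
pose H a b z := cup_form lab S (A :\ a :\ b) z.
have HC a b z : H a b z = H b a z.
  by rewrite /H; congr (cup_form _ _ _ _); apply/setP => i; rewrite !inE andbCA.
pose l := lab j.
transitivity (\sum_(a in A) \sum_(b in A :\ a)
   (l (pt_step b (pt_step a x)) * H a b (pt_step b (pt_step a x))) +
  \sum_(a in A) \sum_(b in A :\ a) (l (pt_step a x) * H a b (pt_step b (pt_step a x))) +
  \sum_(a in A) \sum_(b in A :\ a) (l (pt_step b x) * H a b (pt_step b x)) +
  \sum_(a in A) \sum_(b in A :\ a) (l x * H a b (pt_step b x))).
  rewrite -!big_split; apply: eq_bigr => a aA /=; rewrite -!big_split; apply: eq_bigr => b _ /=.
  by rewrite /l /H !mulrDl !addrA.
rewrite sum_sym_pairs ?add0r; last by move=> a b; rewrite HC pt_stepC.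
rewrite [X in _ + X + _]sum_swap_pairs -big_split /= [X in X + _]big1 ?add0r; last first.
  move=> a aA; rewrite -big_split /=.
  transitivity (l (pt_step a x) * \sum_(b in A :\ a)
      (cup_form lab S (A :\ a :\ b) (pt_step b (pt_step a x)) +
       cup_form lab S (A :\ a :\ b) (pt_step a x))); last by rewrite IH mulr0.
  by rewrite mulr_sumr; apply: eq_bigr => b _; rewrite mulrDr (HC b a).
(* The second sum is symmetric in [a] and [b], hence 0; it is inserted to complete the induction
   hypothesis at [x]. *)
transitivity (\sum_(a in A) \sum_(b in A :\ a) (l x * (H a b (pt_step b x) + H a b x))
   + \sum_(a in A) \sum_(b in A :\ a) (l x * H a b x)).
  rewrite -big_split; apply: eq_bigr => a _; rewrite -big_split; apply: eq_bigr => b _ /=.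
  by rewrite mulrDr -addrA addbb_ring addr0.
rewrite [X in _ + X]sum_sym_pairs ?addr0; last by move=> a b; rewrite HC.
by rewrite big1 // => a aA; rewrite -mulr_sumr (IH (A :\ a) x) mulr0.
Qed.

Definition in_cell (I : finType) (A : {set I}) (x z : I -> nat) :=
  forall i, (x i <= z i <= x i + (i \in A))%N.

(** The coboundary of the [j]-th label is one of the factors and vanishes on every edge of the
    cell. *)
Lemma cup_form_const (I : finType) lab (S : seq I) (A : {set I}) x j c :
  j \in S -> (forall z, in_cell A x z -> lab j z = c) -> cup_form lab S A x = 0.
Proof.
elim: S A x => //= k S IH A x; rewrite inE => /orP[/eqP <-|jS] lc.
  rewrite big1 // => a aA; rewrite !lc ?addbb_ring ?mul0r //.
  - by move=> i; rewrite leqnn leq_addr.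
  - move=> i; rewrite /pt_step leq_addr leq_add2l /=.
    by case: eqP => // ->; rewrite aA.
rewrite big1 // => a aA; rewrite IH ?mulr0 // => z zc; apply: lc => i.
have := zc i; rewrite /pt_step !inE; case: (eqVneq i a) => [->|] /=.
  by rewrite aA addn0 => /andP[le1 ->]; rewrite (leq_trans _ le1) ?leq_addr.
by rewrite addn0.
Qed.

Fixpoint cell_sum (I : eqType) n (l : seq I) (G : (I -> nat) -> bool) y : bool :=
  if l is a :: l' then \sum_(t < n) cell_sum n l' G (pt_set a t y) else G y.

Lemma cell_sum_eq (I : eqType) n (l : seq I) G G' y :
  (forall x, (forall i, i \notin l -> x i = y i) -> G x = G' x) ->
  cell_sum n l G y = cell_sum n l G' y.
Proof.
elim: l y => [|a l IH] y GG' /=; first exact: GG'.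
apply: eq_bigr => t _; apply: IH => x xy; apply: GG' => i.
by rewrite inE negb_or => /andP[/negPf ia /xy ->]; rewrite /pt_set ia.
Qed.

Lemma cell_sum_big (I : eqType) n (l : seq I) (J : finType) (A : {set J}) G y :
  cell_sum n l (fun x => \sum_(a in A) G a x) y = \sum_(a in A) cell_sum n l (G a) y.
Proof.
elim: l y => //= b l IH y; rewrite exchange_big /=.
by apply: eq_bigr => t _; rewrite IH.
Qed.

Lemma cell_sumD (I : eqType) n (l : seq I) G G' y :
  cell_sum n l (fun x => G x + G' x) y = cell_sum n l G y + cell_sum n l G' y.
Proof.
by elim: l y => //= b l IH y; rewrite -big_split; apply: eq_bigr => t _; rewrite IH.
Qed.

Lemma cell_sum_rem (I : eqType) n (l : seq I) a G y : uniq l -> a \in l ->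
  cell_sum n l G y = \sum_(t < n) cell_sum n (rem a l) G (pt_set a t y).
Proof.
elim: l y => //= b l IH y /andP[bl ul]; rewrite inE eq_sym.
case: (eqVneq b a) => [->|ba /= al] //=.
transitivity (\sum_(t < n) \sum_(s < n)
   cell_sum n (rem a l) G (pt_set a s (pt_set b t y))).
  by apply: eq_bigr => t _; rewrite IH.
rewrite exchange_big; apply: eq_bigr => s _ /=; apply: eq_bigr => t _.
by rewrite pt_setC // eq_sym.
Qed.

Lemma cell_sum_step (I : eqType) n (l : seq I) a G y : a \notin l ->
  cell_sum n l (fun x => G (pt_step a x)) y = cell_sum n l G (pt_step a y).
Proof.
elim: l y => //= b l IH y; rewrite inE negb_or => /andP[ab al].
by apply: eq_bigr => t _; rewrite IH // pt_step_set.
Qed.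

Lemma cell_sum_neq0 (I : eqType) n (l : seq I) G y : cell_sum n l G y ->
  exists x, (forall i, i \in l -> (x i < n)%N) /\ (forall i, i \notin l -> x i = y i) /\ G x.
Proof.
elim: l y => [|a l IH] y /=; first by exists y.
move=> sn; have [t /IH [x [xl [xnl Gx]]]] : exists t : 'I_n, cell_sum n l G (pt_set a t y).
  apply: contrapT => nt; move: sn; rewrite big1 // => t _; apply/negbTE/negP => ht.
  by apply: nt; exists t.
exists x; split; [|split] => // i; rewrite inE.
  have [il|il] := boolP (i \in l); first by rewrite xl.
  by rewrite orbF => /eqP ia; rewrite xnl // /pt_set ia eqxx.
by rewrite negb_or => /andP[/negPf ia il]; rewrite xnl // /pt_set ia.
Qed.

Lemma sum_telescope2 n (F : nat -> bool) :
  \sum_(t < n) (F t.+1 + F t) = F n + F 0%N.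
Proof.
elim: n => [|n IH]; first by rewrite big_ord0 addbb_ring.
rewrite big_ord_recr IH /=.
by case: (F n.+1); case: (F n); case: (F 0%N).
Qed.

(* Stokes: the sum telescopes to the face where the head of [S] is labelled by
   [true], since the remaining labels are constant on the other faces. *)
Lemma cup_form_total (I : finType) n lab (S : seq I) y :
  (forall j x, x j = 0%N -> lab j x = false) ->
  (forall j x, x j = n -> lab j x = true) -> uniq S ->
  cell_sum n S (cup_form lab S [set i in S]) y = true.
Proof.
move=> lab0 labn; elim: S y => [|j S IH] y /=.
  by move=> _; apply/eqP/setP => i; rewrite !inE.
move=> /andP[jS uS]; pose A := [set i in j :: S].
pose F a z := lab j z * cup_form lab S (A :\ a) z.
have ujS : uniq (j :: S) by rewrite /= jS.
pose cf x : bool := \sum_(a in A)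
  (lab j (pt_step a x) + lab j x) * cup_form lab S (A :\ a) (pt_step a x).
rewrite -[LHS]/(cell_sum n (j :: S) cf y).
(* Product rule: the remaining factors form a cocycle, so the whole form is the coboundary of [F],
   the head label times these factors. *)
have -> : cell_sum n (j :: S) cf y =
    \sum_(a in A) cell_sum n (j :: S) (fun x => F a (pt_step a x) + F a x) y.
  rewrite -cell_sum_big; apply: cell_sum_eq => x _; rewrite /cf.
  transitivity (\sum_(a in A) (F a (pt_step a x) + F a x) + lab j x * \sum_(a in A)
      (cup_form lab S (A :\ a) (pt_step a x) + cup_form lab S (A :\ a) x)); last first.
    by rewrite cup_form_closed mulr0 addr0.
  rewrite mulr_sumr -big_split.
  apply: eq_bigr => a _ /=; rewrite /F.
  by case: (lab j x); case: (lab j _); case: (cup_form lab S _ x); case: (cup_form _ _ _ _).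
have tele a : a \in A -> cell_sum n (j :: S) (fun x => F a (pt_step a x) + F a x) y =
    cell_sum n (rem a (j :: S)) (F a) (pt_set a n y)
    + cell_sum n (rem a (j :: S)) (F a) (pt_set a 0 y).
  rewrite inE => aS; rewrite (cell_sum_rem _ _ _ ujS aS).
  rewrite -(sum_telescope2 n (fun t => cell_sum n (rem a (j :: S)) (F a) (pt_set a t y))).
  apply: eq_bigr => t _; rewrite cell_sumD cell_sum_step ?pt_step_set_same //.
  by rewrite mem_rem_uniqF.
have cell0 (l : seq I) z : cell_sum n l (fun=> false) z = false.
  by elim: l z => //= b l IHl z; rewrite big1.
(* On a face orthogonal to [a], the label of [a] is constant, and [a <> j] is still among the
   remaining factors. *)
have face a t : a \in A -> a != j -> t = n \/ t = 0%N ->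
    cell_sum n (rem a (j :: S)) (F a) (pt_set a t y) = 0.
  move=> aA aj tn; rewrite -[RHS](cell0 (rem a (j :: S)) (pt_set a t y)).
  apply: cell_sum_eq => x xE; rewrite /F.
  have xa : x a = t by rewrite xE ?mem_rem_uniqF // /pt_set eqxx.
  have aS : a \in S by move: aA; rewrite !inE (negPf aj).
  rewrite (@cup_form_const _ _ _ _ _ a (lab a x) aS) ?mulr0 // => z zc.
  have za : z a = t by have := zc a; rewrite !inE eqxx xa addn0 -eqn_leq => /eqP.
  by case: tn => tE; rewrite tE in za xa; [rewrite !labn | rewrite !lab0].
have jA : j \in A by rewrite !inE eqxx.
rewrite (bigD1 j jA) big1 ?addr0; last first.
  by move=> a /andP[aA aj]; rewrite (tele a aA) !face ?addr0 //; auto.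
have remj : rem j (j :: S) = S by rewrite /= eqxx.
rewrite (tele j jA) remj.
have -> : cell_sum n S (F j) (pt_set j 0 y) = false.
  rewrite -[RHS](cell0 S (pt_set j 0 y)); apply: cell_sum_eq => x xE; rewrite /F.
  by rewrite lab0 ?mul0r // xE // /pt_set eqxx.
transitivity (cell_sum n S (F j) (pt_set j n y)); first by case: (cell_sum _ _ _ _).
rewrite -[RHS](IH (pt_set j n y)) //; apply: cell_sum_eq => x xE; rewrite /F.
rewrite labn ?mul1r; last by rewrite xE // /pt_set eqxx.
congr (cup_form _ _ _ _); apply/setP => i; rewrite !inE.
by case: (eqVneq i j) => // ->; rewrite (negPf jS).
Qed.

(** The form sums to 1 over all cells, so it is nonzero on some cell, and by [cup_form_const] no
    label is constant there. *)
Lemma discrete_poincare_miranda (I : finType) n (lab : I -> (I -> nat) -> bool) :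
  (forall j x, x j = 0%N -> lab j x = false) ->
  (forall j x, x j = n -> lab j x = true) ->
  exists x : I -> nat, (forall i, (x i < n)%N) /\
    forall j, exists z z', [/\ in_cell [set: I]%SET x z, in_cell [set: I]%SET x z',
      lab j z = false & lab j z' = true].
Proof.
move=> lab0 labn.
have /cell_sum_neq0 [x [xn [_ Jx]]] :=
  cup_form_total (fun=> 0%N) lab0 labn (enum_uniq I).
exists x; split=> [i|j]; first by rewrite xn // mem_enum.
have eT : [set i in enum I] = [set: I]%SET.
  by apply/setP => i; rewrite !inE mem_enum.
rewrite eT in Jx; have jI : j \in enum I by rewrite mem_enum.
have ex c : exists z, in_cell [set: I]%SET x z /\ lab j z = c.
  apply: contrapT => nz; move: Jx; rewrite (cup_form_const (c := ~~ c) jI) // => z zc.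
  by have [lc|] := eqVneq (lab j z) c; [case: nz; exists z | by case: (c) (lab j z) => [] []].
by have [z [zc lz]] := ex false; have [z' [zc' lz']] := ex true; exists z, z'.
Qed.

Local Open Scope classical_set_scope.

(** * Metric spaces *)

Lemma natSinv_near (R : realType) (e : R) : 0 < e ->
  \forall n \near \oo, n.+1%:R^-1 < e.
Proof.
move=> e0; near=> n; rewrite invf_plt ?posrE //.
apply: (@le_lt_trans _ _ n%:R); last by rewrite ltr_nat.
by near: n; exact: nbhs_infty_ger.
Unshelve. all: by end_near. Qed.

Lemma compact_uniform (R : realType) (X : topologicalType) (K : set X) (P : X -> R -> Prop) :
  compact K ->
  (forall x, K x -> exists2 r : R, 0 < r & \forall y \near x, forall r', 0 < r' -> r' <= r -> P y r') ->
  exists2 r : R, 0 < r & forall x, K x -> P x r.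
Proof.
move=> /compact_near_coveringP cK loc.
have : \forall n \near \oo, K `<=` (fun x => P x (n.+1%:R^-1 : R)).
  apply: cK => x /loc [r r0 near_x].
  exists ([set y | forall r', 0 < r' -> r' <= r -> P y r'],
          [set n : nat | n.+1%:R^-1 < r]) => /=.
    by split=> //; exact: natSinv_near.
  by move=> [y n] /= [Py nr]; apply: Py; rewrite ?ltW // invr_gt0.
by move=> [N _ KN]; exists N.+1%:R^-1; [rewrite invr_gt0|exact: (KN N (leqnn N))].
Qed.

Lemma compact_set_type (X : topologicalType) (A : set X) :
  compact A -> compact [set: (A : Type)].
Proof.
move=> cA F FF _.
have FA : F ((set_val : A -> X) @^-1` A).
  by apply: (filterS _ filterT) => x _; exact: set_valP.
have [x [Ax clx]] := cA ((set_val : A -> X) @ F) _ FA.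
exists (exist _ x (mem_set Ax)); split=> // P Q FP [W [[O oO <-] /= Ox OQ]].
have FP' : F ((set_val : A -> X) @^-1` ((set_val : A -> X) @` P)).
  by apply: (filterS _ FP) => w Pw; exists w.
have [y [[w Pw wy] Oy]] := clx _ O FP' (open_nbhs_nbhs (conj oO Ox)).
exists w; split=> //; move: Oy; rewrite -wy. exact: OQ.
Qed.

Lemma frontier_closed (X : topologicalType) (U : set X) : closed (frontier U).
Proof.
rewrite /frontier setDE; apply: closedI; first exact: closed_closure.
by apply: open_closedC; exact: open_interior.
Qed.

Lemma mdist_nbhsP (R : realType) (T : metricType R) (x : T) (A : set T) :
  nbhs x A <-> exists2 e : R, 0 < e & forall y, mdist x y < e -> A y.
Proof.
split=> [/nbhs_ballP[e /= e0 xeA]|[e e0 xeA]].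
  by exists e => // y xy; apply: xeA; rewrite ballEmdist.
by apply/nbhs_ballP; exists e => //= y; rewrite ballEmdist => /xeA.
Qed.

Lemma mdist_openP (R : realType) (T : metricType R) (A : set T) :
  open A <-> forall x, A x -> exists2 e : R, 0 < e & forall y, mdist x y < e -> A y.
Proof.
rewrite openE; split=> [oA x /oA /mdist_nbhsP //|oA x /oA Ax]; exact/mdist_nbhsP.
Qed.

Lemma mdist_ball_open (R : realType) (T : metricType R) (x : T) (e : R) :
  open [set y | mdist x y < e].
Proof.
apply/mdist_openP => y /= xy; exists (e - mdist x y); first by rewrite subr_gt0.
by move=> z yz; apply: (le_lt_trans (metric_triangle x y z)); rewrite -ltrBrDl.
Qed.

Lemma mdist_closureP (R : realType) (T : metricType R) (A : set T) x :
  closure A x <-> forall e : R, 0 < e -> exists2 y, A y & mdist x y < e.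
Proof.
split=> [clA e e0|clA B /mdist_nbhsP [e e0 xB]].
  have [|y [Ay xy]] := clA [set y | mdist x y < e]; last by exists y.
  by apply/mdist_nbhsP; exists e.
by have [y Ay xy] := clA e e0; exists y; split=> //; exact: xB.
Qed.

Lemma not_closed_mdist (R : realType) (T : metricType R) (A : set T) x :
  closed A -> ~ A x -> exists2 e : R, 0 < e & forall y, mdist x y < e -> ~ A y.
Proof.
by move=> cA nAx; have /mdist_openP := closed_openC cA; apply.
Qed.

Lemma ball_subset_closed (R : realType) (T : metricType R) (U : set T) (d : R) :
  closed [set x | forall y, mdist x y < d -> U y].
Proof.
apply/closure_id/seteqP; split; first exact: subset_closure.
move=> x /mdist_closureP clx y xy.
have [z zU xz] : exists2 z, (forall y, mdist z y < d -> U y) & mdist x z < d - mdist x y.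
  by apply: clx; rewrite subr_gt0.
apply: zU; rewrite (le_lt_trans (metric_triangle z x y)) // metric_sym.
by rewrite -ltrBrDr.
Qed.

Lemma compact_closed_metric (R : realType) (T : metricType R) (K : set T) :
  compact K -> closed K.
Proof. by apply: compact_closed; exact: metric_hausdorff. Qed.

Lemma lebesgue_number (R : realType) (T : metricType R) (K : set T) (I : Type)
    (O : I -> set T) :
  compact K -> (forall i, open (O i)) -> (forall x, K x -> exists i, O i x) ->
  exists2 d : R, 0 < d & forall x, K x -> exists i, forall y, mdist x y < d -> O i y.
Proof.
move=> cK oO cov.
apply: (compact_uniform (P := fun x d => exists i, forall y, mdist x y < d -> O i y)) cK _.
move=> x /cov [i Oix]; have /mdist_openP/(_ _ Oix) [e e0 xeO] := oO i.
exists (e / 2); first by rewrite divr_gt0.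
apply/mdist_nbhsP; exists (e / 2); first by rewrite divr_gt0.
move=> y xy r r0 re; exists i => z yz; apply: xeO.
apply: (le_lt_trans (metric_triangle x y z)); rewrite [e]splitr.
by rewrite ltrD // (lt_le_trans yz).
Qed.

Definition separated_by (Y : topologicalType) (A B U V : set Y) :=
  [/\ open U, open V, A `<=` U, B `<=` V & U `&` V = set0].

Lemma separated_open (R : realType) (Y : metricType R) (P Q : set Y) :
  closure P `&` Q = set0 -> P `&` closure Q = set0 ->
  exists U V, separated_by P Q U V.
Proof.
move=> clPQ PclQ.
pose O (P Q : set Y) := [set y | exists p e, [/\ P p, 0 < e :> R, mdist p y < e / 2 &
  forall q, Q q -> e <= mdist p q]].
have oO P' Q' : open (O P' Q').
  apply/mdist_openP => y [p [e [Pp e0 py Qe]]]; exists (e / 2 - mdist p y).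
    by rewrite subr_gt0.
  move=> z yz; exists p, e; split=> //.
  by rewrite (le_lt_trans (metric_triangle p y z)) // -ltrBrDl.
have sO P' Q' : P' `&` closure Q' = set0 -> P' `<=` O P' Q'.
  move=> PQ p Pp; have ncl : ~ closure Q' p.
    by move=> Qp; have : (P' `&` closure Q') p by []; rewrite PQ.
  have [e e0 pe] := not_closed_mdist (@closed_closure _ Q') ncl.
  exists p, e; split=> //; first by rewrite mdistxx divr_gt0.
  by move=> q Qq; rewrite leNgt; apply/negP => /pe; apply; exact: subset_closure.
exists (O P Q), (O Q P); split=> //; [exact: sO|by apply: sO; rewrite setIC|].
rewrite -subset0 => y [[p [e [Pp e0 py Qe]]] [q [e' [Qq e'0 qy Pe]]]].
have pq : mdist p q < e / 2 + e' / 2.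
  by rewrite (le_lt_trans (metric_triangle p y q)) // ltrD // metric_sym.
have := Qe q Qq; have := Pe p Pp; rewrite metric_sym => h1 h2.
have : e + e' <= mdist p q + mdist p q by rewrite lerD.
rewrite leNgt => /negP; apply; rewrite [e]splitr [e']splitr addrACA.
by rewrite ltrD.
Qed.

(** * Partitions in spaces of small ind *)

Lemma compact_finite_cover (X : topologicalType) (U : X -> set X) :
  compact [set: X] -> (forall x, open (U x)) -> (forall x, U x x) ->
  exists D : seq X, forall z, exists2 x, x \in D & U x z.
Proof.
move=> /compact_near_coveringP cX oU Ux.
(* The filter of lists directed by inclusion: a property holds eventually if it holds for all lists
   containing a given one. *)
pose F : set_system (seq X) :=
  [set S | exists D0 : seq X, forall D : seq X, {subset D0 <= D} -> S D].
have FF : Filter F.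
  apply: Build_Filter; first by exists [::].
    move=> P Q [D hP] [D' hQ]; exists (D ++ D') => D'' sub; split.
      by apply: hP => x xD; apply: sub; rewrite mem_cat xD.
    by apply: hQ => x xD; apply: sub; rewrite mem_cat xD orbT.
  by move=> P Q PQ [D hP]; exists D => D' /hP /PQ.
have [|D hD] := cX _ F (fun D z => exists2 x, x \in D & U x z) FF.
  move=> x _; exists (U x, [set D : seq X | x \in D]) => /=.
    split; first by apply: open_nbhs_nbhs; split.
    by exists [:: x] => D; apply; rewrite inE eqxx.
  by move=> [z D] /= [Uz xD]; exists x.
by exists D => z; apply: (hD D).
Qed.

(** [ind_le] passes to frontiers of frontiers, which are nested subtypes. Keeping a compact space
    with an injection into [Y] spares the transfer of [ind_le] along homeomorphisms; for metric [Y]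
    the injection is an embedding. *)
Definition ind_image (Y : topologicalType) (S : set Y) (d : option ordnum) :=
  exists (X : topologicalType) (j : X -> Y),
    [/\ compact [set: X], continuous j, injective j, range j = S & ind_le X d].

(** What a partition leaves is only known to be covered by finitely many frontiers of small ind.
    Keeping the pieces apart avoids a sum theorem for ind. *)
Definition ind_cover (Y : topologicalType) (T : set Y) (D : option ordnum -> Prop) :=
  exists (I : finType) (F : I -> set Y),
    (forall i, exists2 d, D d & ind_image (F i) d) /\ T `<=` \bigcup_i F i.

Lemma ind_image_compact (Y : topologicalType) (S : set Y) d :
  ind_image S d -> compact S.
Proof.
move=> [X [j [cX cj _ <- _]]]; apply: continuous_compact cX.
by apply: continuous_subspaceT => x; exact: cj.
Qed.

Lemma ind_image_frontier (Y X : topologicalType) (j : X -> Y) (U : set X) d :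
  compact [set: X] -> continuous j -> injective j ->
  ind_le (frontier U : Type) d -> ind_image (j @` frontier U) d.
Proof.
move=> cX cj ij Fd; exists (frontier U : Type), (j \o set_val); split=> //.
- apply: compact_set_type; apply: subclosed_compact cX _ => //.
  exact: frontier_closed.
- move=> x; apply: continuous_comp; [exact: initial_continuous|exact: cj].
- by move=> x y /= /ij; exact: val_inj.
- apply/seteqP; split=> [y [x _ <-]|y [x Fx <-]].
    by exists (set_val x) => //; exact: set_valP.
  by exists (exist _ x (mem_set Fx)).
Qed.

(** Finitely many small neighbourhoods cover [X], each with closure off [A] or off [B]. The union
    [G] of those off [B] has its boundary inside finitely many small frontiers. The partition
    extends to [Y] because [A] with [G], and [B] with the exterior of [G], are separated sets. *)
Lemma small_partition (R : realType) (Y : metricType R) (S A B : set Y) a :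
  ind_image S (Some a) -> closed A -> closed B -> A `&` B = set0 ->
  exists U V, separated_by A B U V /\
    ind_cover (S `\` (U `|` V)) (fun d => dim_lt d (Some a)).
Proof.
move=> [X [j [cX cj ij <- Xa]]] cA cB AB.
have oj (O : set Y) : open O -> open (j @^-1` O).
  by move=> oO; apply: open_comp => // x _; exact: cj.
have AB0 y : A y -> B y -> False.
  by move=> Ay By; have : (A `&` B) y by []; rewrite AB.
have loc (x : X) : exists U : set X, [/\ open U, U x,
    exists2 d, dim_lt d (Some a) & ind_le (frontier U : Type) d &
    closure U `&` j @^-1` A = set0 \/ closure U `&` j @^-1` B = set0].
  have [C [cC nC CAB]] : exists C : set Y, [/\ closed C, ~ C (j x) & C = A \/ C = B].
    have [Ax|] := pselect (A (j x)); last by exists A; split=> //; left.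
    by exists B; split=> //; [move=> /(AB0 _ Ax)|right].
  have [e e0 xe] := not_closed_mdist cC nC.
  have [||U [d [oU Ux UV da Fd]]] :=
      @ind_le_Some _ _ Xa x (j @^-1` [set y | mdist (j x) y < e / 2]).
  - by apply: oj; exact: mdist_ball_open.
  - by rewrite /= mdistxx divr_gt0.
  exists U; split=> //; first by exists d.
  suff E : closure U `&` j @^-1` C = set0 by case: CAB => CE; rewrite -CE; auto.
  rewrite -subset0 => z [clz Cz]; apply: xe Cz.
  have [|w [/UV /= xw zw]] := clz (j @^-1` [set y | mdist (j z) y < e / 2]).
    apply: open_nbhs_nbhs; split; last by rewrite /= mdistxx divr_gt0.
    by apply: oj; exact: mdist_ball_open.
  rewrite [e]splitr (le_lt_trans (metric_triangle (j x) (j w) (j z))) //.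
  by rewrite ltrD // metric_sym.
have [U HU] := choice loc.
have [||D DX] := @compact_finite_cover X U cX; try by move=> x; case: (HU x).
(* A neighbourhood that meets [A] cannot be off [A], so its centre is in [E]; hence [G] contains the
   trace of [A]. *)
pose E := [set` D] `&` [set x | closure (U x) `&` j @^-1` B = set0].
have finE : finite_set E by apply: finite_setIl; exact: finite_seq.
pose G := \bigcup_(x in E) U x; pose cG := \bigcup_(x in E) closure (U x).
have ccG : closed cG by apply: closed_bigcup => // x _; exact: closed_closure.
have oG : open G by apply: bigcup_open => x _; case: (HU x).
have GcG : G `<=` cG by move=> z [x Ex Uz]; exists x => //; exact: subset_closure.
have AG z : A (j z) -> G z.
  move=> Az; have [x Dx Uz] := DX z; exists x => //; split=> //=.
  have [_ _ _ [clA|//]] := HU x.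
  have : (closure (U x) `&` j @^-1` A) z by split=> //; exact: subset_closure.
  by rewrite clA.
have cGB z : cG z -> B (j z) -> False.
  move=> [x [_ Ex] Uz] Bz; have : (closure (U x) `&` j @^-1` B) z by [].
  by rewrite Ex.
have jclosed C : closed C -> closed (j @` C).
  move=> cC; apply: compact_closed_metric; apply: continuous_compact.
    by apply: continuous_subspaceT => x; exact: cj.
  exact: subclosed_compact cX _.
have [|| UU [V [oU oV PU QV UV]]] := @separated_open R Y (A `|` j @` G) (B `|` j @` (~` cG)).
- rewrite -subset0 => y [clP Qy].
  have : (A `|` j @` cG) y.
    move: y clP {Qy}; rewrite (closure_id (A `|` j @` cG)).1; last by apply: closedU => //; exact: jclosed.
    by apply: closureS; apply: setUS; exact: image_subset.
  case=> [Ay|[z Gz zy]]; case: Qy => [By|[w nGw wy]].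
  + exact: AB0 Ay By.
  + by apply: nGw; apply: GcG; apply: AG; rewrite wy.
  + by apply: (cGB z) => //; rewrite zy.
  + by apply: nGw; have -> : w = z by apply: ij; rewrite wy.
- rewrite -subset0 => y [Py clQ].
  have : (B `|` j @` (~` G)) y.
    move: y clQ {Py}; rewrite (closure_id (B `|` j @` (~` G))).1; last first.
      by apply: closedU => //; apply: jclosed; exact: open_closedC.
    by apply: closureS; apply: setUS; apply: image_subset; exact: subsetC.
  case=> [By|[z nGz zy]]; case: Py => [Ay|[w Gw wy]].
  + exact: AB0 Ay By.
  + by apply: (cGB w); [exact: GcG|rewrite wy].
  + by apply: nGz; apply: AG; rewrite zy.
  + by apply: nGz; have -> : z = w by apply: ij; rewrite wy.
exists UU, V; split.
  by split=> // y ?; [apply: PU; left|apply: QV; left].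
exists (seq_sub D), (fun x => j @` frontier (U (val x))); split=> [x|y [[z _ zy] nUV]].
  have [_ _ [d da Fd] _] := HU (val x); exists d => //.
  exact: ind_image_frontier.
have nG : ~ G z by move=> Gz; apply: nUV; left; apply: PU; right; exists z.
have [x Ex Uz] : cG z.
  by apply: contrapT => nGz; apply: nUV; right; apply: QV; right; exists z.
have xD : x \in D by case: Ex.
exists (SeqSub xD) => //; exists z => //; split=> //.
by move=> /= /interior_subset Uxz; apply: nG; exists x.
Qed.

(** With [Q] empty, the pairs indexed by [P] form an inessential family on [T]. A larger [Q] holds
    the points of [T] that may lie on all partitions chosen so far and are left to the pairs of
    later stages. *)
Definition inessential_off (Y : topologicalType) (J : Type) (A B : J -> set Y)
    (P : set J) (Q T : set Y) :=
  exists U V : J -> set Y,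
    (forall j, P j -> separated_by (A j) (B j) (U j) (V j)) /\
    T `<=` Q `|` \bigcup_(j in P) (U j `|` V j).

Definition closed_pairs (Y : topologicalType) (J : Type) (A B : J -> set Y) :=
  forall j, [/\ closed (A j), closed (B j) & A j `&` B j = set0].

Lemma inessential_off_comp (Y : topologicalType) (J : Type) (A B : J -> set Y)
    (P1 P2 : set J) (Q1 Q2 T : set Y) :
  inessential_off A B P1 Q1 T -> inessential_off A B P2 Q2 Q1 ->
  P1 `&` P2 = set0 -> inessential_off A B (P1 `|` P2) Q2 T.
Proof.
move=> [U1 [V1 [s1 c1]]] [U2 [V2 [s2 c2]]] P12.
have P12F j : P1 j -> P2 j -> False.
  by move=> p1 p2; have : (P1 `&` P2) j by []; rewrite P12.
exists (fun j => if pselect (P1 j) then U1 j else U2 j).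
exists (fun j => if pselect (P1 j) then V1 j else V2 j).
split=> [j|y Ty]; first by case: pselect => [p1 _|np1 [//|]]; [exact: s1|exact: s2].
have [Q1y|[j Pj UVj]] := c1 y Ty; last first.
  by right; exists j; [left|case: pselect].
have [Q2y|[j Pj UVj]] := c2 y Q1y; first by left.
by right; exists j; [right|case: pselect => // p1; case: (P12F j)].
Qed.

Lemma inessential_off_subset (Y : topologicalType) (J : Type) (A B : J -> set Y)
    (P P' : set J) (Q T T' : set Y) :
  P `<=` P' -> T' `<=` T -> (forall j, P' j -> exists U V, separated_by (A j) (B j) U V) ->
  inessential_off A B P Q T -> inessential_off A B P' Q T'.
Proof.
move=> PP' TT' sep [U1 [V1 [s1 c1]]].
have /choice[UV HUV] : forall j, exists W : set Y * set Y,
    P' j -> separated_by (A j) (B j) W.1 W.2.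
  move=> j; have [/sep [U [V UVj]]|nP] := pselect (P' j).
    by exists (U, V).
  by exists (set0, set0).
exists (fun j => if pselect (P j) then U1 j else (UV j).1).
exists (fun j => if pselect (P j) then V1 j else (UV j).2).
split=> [j P'j|y /TT' Ty]; first by case: pselect => [pj|npj]; [exact: s1|exact: HUV].
have [Qy|[j Pj UVj]] := c1 y Ty; first by left.
by right; exists j; [exact: PP'|case: pselect].
Qed.

Lemma closed_pair_separated (R : realType) (Y : metricType R) (A B : set Y) :
  closed A -> closed B -> A `&` B = set0 -> exists U V, separated_by A B U V.
Proof.
by move=> /closure_id clA /closure_id clB AB; have := @separated_open R Y A B; rewrite -clA -clB; apply.
Qed.

Lemma ind_cover_bigcup (Y : topologicalType) (I : finType) (T : I -> set Y) D :
  (forall i, ind_cover (T i) D) -> ind_cover (\bigcup_i T i) D.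
Proof.
move=> cov; pose J i := projT1 (cid (cov i)).
pose F i := projT1 (cid (projT2 (cid (cov i)))).
have FT i := projT2 (cid (projT2 (cid (cov i)))).
exists {i : I & J i}, (fun u => F (tag u) (tagged u)); split=> [[i j]|y [i _ Ty]] /=.
  exact: (FT i).1.
by have [j _ Fy] := (FT i).2 y Ty; exists (Tagged J j).
Qed.

Lemma fin_ord_max (a : ordnum) (I : finType) (y : I -> a) (i1 : I) :
  exists i0, forall i, ord_rel (y i) (y i0).
Proof.
have [i0 Hi0] : exists i0, forall i, i \in enum I -> ord_rel (y i) (y i0).
  elim: (enum I) => [|i s [i0 IH]]; first by exists i1.
  have [ii0|i0i] := ord_total (y i) (y i0).
    by exists i0 => j; rewrite inE => /orP[/eqP ->|/IH].
  exists i => j; rewrite inE => /orP[/eqP ->|/IH ji0]; first exact: ord_refl.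
  exact: ord_trans ji0 i0i.
by exists i0 => i; apply: Hi0; rewrite mem_enum.
Qed.

(** Finitely many values below [x] have a maximum below [x]; pieces of dimension -1 are empty and
    are dropped. *)
Lemma ind_cover_lt (Y : topologicalType) (T : set Y) (a : ordnum) (x : a) :
  ind_cover T (fun d => dim_lt d (Some (iseg x))) ->
  T = set0 \/ exists2 y, ~ ord_rel x y & ind_cover T (fun d => dim_le d (Some (iseg y))).
Proof.
move=> [I [F [HF TF]]].
have {}HF i : F i = set0 \/ exists2 y, ~ ord_rel x y & exists d, dim_le d (Some (iseg y)) /\
    ind_image (F i) d.
  have [d /dim_lt_isegP [->|[y yx dy]] Fd] := HF i; last by right; exists y => //; exists d.
  left; have [X [j [_ _ _ <- /ind_le_None X0]]] := Fd.
  by rewrite -subset0 => w [z zT _]; rewrite X0 in zT.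
have [F0|/existsNP[i1 nF1]] := pselect (forall i, F i = set0).
  by left; rewrite -subset0 => y /TF [i _]; rewrite F0.
have [y1 y1x] : exists y, ~ ord_rel x y by have [//|[y yx _]] := HF i1; exists y.
have /choice[y Hy] : forall i, exists y, ~ ord_rel x y /\ (F i = set0 \/
    exists d, dim_le d (Some (iseg y)) /\ ind_image (F i) d).
  by move=> i; have [F0|[y yx Fd]] := HF i; [exists y1|exists y]; auto.
right; have [i0 y0max] := fin_ord_max y i1; exists (y i0); first by case: (Hy i0).
exists {i : I | `[< F i <> set0 >]}, (fun u => F (val u)); split=> [[i /= Fi]|z /TF [i _ Fz]].
  have [_ [F0|[d [dy Fd]]]] := Hy i; first by move/asboolP: Fi.
  by exists d => //; apply: dim_le_trans dy _; exact: iseg_mono.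
have Fi : `[< F i <> set0 >] by apply/asboolP => F0; rewrite F0 in Fz.
by exists (exist _ i Fi).
Qed.

(** The partitions found for [S] are shrunk and added to the pairs themselves, so that separating
    the enlarged pairs over [T] still covers [S]. This is why [P] has to work for all closed
    pairs. *)
Lemma inessential_offU (R : realType) (Y : metricType R) (J : Type) (P : set J) (S T : set Y) :
  compact S ->
  (forall A B : J -> set Y, closed_pairs A B -> inessential_off A B P set0 S) ->
  (forall A B : J -> set Y, closed_pairs A B -> inessential_off A B P set0 T) ->
  forall A B : J -> set Y, closed_pairs A B -> inessential_off A B P set0 (S `|` T).
Proof.
move=> cS iS iT A B AB; have [U [V [sUV SUV]]] := iS A B AB.
pose O (u : {j | P j} * bool) := if u.2 then U (sval u.1) else V (sval u.1).
have [||d d0 Hd] := @lebesgue_number R Y S _ O cS.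
- by move=> [[j Pj] b]; rewrite /O; case: b => /=; case: (sUV j Pj).
- move=> x /SUV [//|[j Pj [Ux|Vx]]]; [exists (exist _ j Pj, true)|exists (exist _ j Pj, false)] => //.
(* As [d] is a Lebesgue number, the shrunken sets still cover [S], and they are closed. *)
pose sh (W : set Y) := [set x | forall y, mdist x y < d -> W y].
have shW W : sh W `<=` W by move=> x; apply; rewrite mdistxx.
pose A' j := if pselect (P j) then A j `|` sh (U j) else A j.
pose B' j := if pselect (P j) then B j `|` sh (V j) else B j.
have AB' : closed_pairs A' B'.
  move=> j; have [cA cB AB0] := AB j; rewrite /A' /B'; case: pselect => // Pj.
  split; try by apply: closedU => //; exact: ball_subset_closed.
  have [_ _ AU BV UV] := sUV j Pj; rewrite -subset0 -UV => y [Ay By]; split.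
  - by case: Ay => [/AU|/shW].
  - by case: By => [/BV|/shW].
have [U' [V' [sUV' TUV']]] := iT A' B' AB'.
exists U', V'; split=> [j Pj|y [Sy|/TUV' //]].
  have [oU' oV' AU' BV' UV'] := sUV' j Pj; split=> //.
  - by move=> y Ay; apply: AU'; rewrite /A'; case: pselect => // pj; left.
  - by move=> y By; apply: BV'; rewrite /B'; case: pselect => // pj; left.
have [[[j Pj] b] Hj] := Hd y Sy; right; exists j => //.
have [_ _ AU' BV' _] := sUV' j Pj.
case: b Hj => Hj; [left; apply: AU'|right; apply: BV']; rewrite /A' /B';
  by case: pselect => // pj; right.
Qed.

Lemma inessential_off0 (Y : topologicalType) (J : Type) (A B : J -> set Y) P Q :
  (forall j, P j -> exists U V, separated_by (A j) (B j) U V) ->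
  inessential_off A B P Q set0.
Proof.
move=> sep; apply: (@inessential_off_subset _ _ _ _ set0 P Q set0) => //.
by exists (fun=> set0), (fun=> set0); split=> [j []|y []].
Qed.

Lemma closed_pairs_separated (R : realType) (Y : metricType R) (J : Type) (A B : J -> set Y) :
  closed_pairs A B -> forall j, exists U V, separated_by (A j) (B j) U V.
Proof. by move=> AB j; have [cA cB AB0] := AB j; exact: closed_pair_separated. Qed.

(** The pair of [x] leaves pieces of smaller dimension for the pairs below [x], and
    [inessential_offU] lets all pieces share the same pairs. For infinite [x] these pairs are
    infinitely many and yield no clique, hence [inessential_branch]. *)
Lemma inessential_below (R : realType) (Y : metricType R) (a : ordnum) (x : a) :
  forall T : set Y, ind_cover T (fun d => dim_le d (Some (iseg x))) ->
  forall A B : a -> set Y, closed_pairs A B ->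
  inessential_off A B [set y | ord_rel y x] set0 T.
Proof.
elim/ordP_ind: x => x IH T [I [F [HF TF]]] A B AB.
have {}HF i : ind_image (F i) (Some (iseg x)).
  by have [d dx [X [j [? ? ? ? Xd]]]] := HF i; exists X, j; split=> //; exact: ind_le_mono Xd dx.
have piece i A' B' : closed_pairs A' B' ->
    inessential_off A' B' [set y | ord_rel y x] set0 (F i).
  move=> AB'; have [cA cB AB0] := AB' x.
  have [U [V [sUV cov]]] := small_partition (HF i) cA cB AB0.
  have step : inessential_off A' B' [set x] (F i `\` (U `|` V)) (F i).
    exists (fun=> U), (fun=> V); split=> [j ->//|y Fy].
    have [UVy|nUV] := pselect ((U `|` V) y); last by left.
    by right; exists x.
  have [E0|[y nxy covy]] := ind_cover_lt cov.
    apply: inessential_off_subset (_ : inessential_off A' B' [set x] set0 (F i)) => //.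
    - by move=> _ ->; exact: ord_refl.
    - by move=> j _; exact: closed_pairs_separated.
    - by rewrite -E0.
  apply: inessential_off_subset (inessential_off_comp step (IH y nxy _ covy _ _ AB') _) => //.
  - by move=> z [->|/= zy]; [exact: ord_refl|exact: ord_trans zy (ord_nle nxy)].
  - by move=> j _; exact: closed_pairs_separated.
  - by rewrite -subset0 => z [-> /= /nxy].
have : forall s : seq I, forall A' B', closed_pairs A' B' ->
    inessential_off A' B' [set y | ord_rel y x] set0 (\bigcup_(i in [set` s]) F i).
  elim=> [|i s IHs] A' B' AB'.
    rewrite set_nil bigcup_set0; apply: inessential_off0 => j _.
    exact: closed_pairs_separated.
  have -> : \bigcup_(k in [set` i :: s]) F k = F i `|` \bigcup_(k in [set` s]) F k.
    apply/seteqP; split=> y.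
      by move=> [k /=]; rewrite inE => /predU1P[->|ks] Fy; [left|right; exists k].
    move=> [Fy|[k /= ks Fy]]; first by exists i; rewrite //= inE eqxx.
    by exists k; rewrite //= inE ks orbT.
  apply: inessential_offU AB' => //.
    exact: ind_image_compact (HF i).
  exact: piece.
move=> /(_ (enum I) A B AB); apply: inessential_off_subset => //.
- by move=> y /TF [i _ Fy]; exists i => //=; rewrite mem_enum.
- by move=> j _; exact: closed_pairs_separated.
Qed.

Definition is_suffix (T : Type) (u v : seq T) := exists s, v = s ++ u.

Definition lex_lt (a : ordnum) (p q : a * nat) : bool :=
  `[< ~ ord_rel q.1 p.1 \/ p.1 = q.1 /\ (p.2 < q.2)%N >].

(* Every piece of the cover gets its own pair, indexed by a node [(x, k) :: _]:
   there is no sum theorem for infinite values of ind. *)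
Lemma inessential_branch (R : realType) (Y : metricType R) (a : ordnum) (x : a) :
  forall (T : set Y) (l : seq (a * nat)),
  ind_cover T (fun d => dim_le d (Some (iseg x))) ->
  forall A B : seq (a * nat) -> set Y, closed_pairs A B ->
  exists w, [/\ pairwise (@lex_lt a) w, all (fun p => ord_rel p.1 x) w &
    inessential_off A B [set u | is_suffix u (w ++ l) /\ (size l < size u)%N] set0 T].
Proof.
elim/ordP_ind: x => x IH T l [I [F [HF TF]]] A B AB.
have {}HF i : ind_image (F i) (Some (iseg x)).
  by have [d dx [X [j [? ? ? ? Xd]]]] := HF i; exists X, j; split=> //; exact: ind_le_mono Xd dx.
(* One new node per piece: the ordinal [x] with counters from 0 on, and [N i] is the suffix of
   [w0 ++ l] starting at the counter of [i]. *)
pose w0 := [seq (x, k) | k <- iota 0 #|I|]; have sw0 : size w0 = #|I|.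
  by rewrite size_map size_iota.
pose N (i : I) := drop (enum_rank i) w0 ++ l.
have sN i : size (N i) = (#|I| - enum_rank i + size l)%N.
  by rewrite size_cat size_drop sw0.
have injN : injective N.
  move=> i i' /(congr1 size); rewrite !sN => /addIn E.
  apply: enum_rank_inj; apply: val_inj => /=.
  rewrite -[LHS](subKn (ltnW (ltn_ord (enum_rank i)))) E subKn //.
  exact: ltnW (ltn_ord _).
have Nsuf i : is_suffix (N i) (w0 ++ l) /\ (size l < size (N i))%N.
  split; first by exists (take (enum_rank i) w0); rewrite catA cat_take_drop.
  by rewrite sN -[X in (X < _)%N]add0n ltn_add2r subn_gt0 ltn_ord.
have /choice[UV HUV] : forall i, exists UV : set Y * set Y,
    separated_by (A (N i)) (B (N i)) UV.1 UV.2 /\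
    ind_cover (F i `\` (UV.1 `|` UV.2)) (fun d => dim_lt d (Some (iseg x))).
  move=> i; have [cA cB AB0] := AB (N i).
  by have [U [V ?]] := small_partition (HF i) cA cB AB0; exists (U, V).
have fibN i : [set i' | N i' = N i] = [set i].
  by apply/seteqP; split=> [i' /injN|i' ->].
have step : inessential_off A B (range N)
    (\bigcup_i (F i `\` ((UV i).1 `|` (UV i).2))) (\bigcup_i F i).
  (* [N] is injective, so each union has at most one member; it only rewrites sets indexed by [i] as
     sets indexed by [u]. *)
  exists (fun u => \bigcup_(i in [set i | N i = u]) (UV i).1).
  exists (fun u => \bigcup_(i in [set i | N i = u]) (UV i).2).
  split=> [_ [i _ <-]|y [i _ Fy]].
    by rewrite fibN !bigcup_set1; case: (HUV i).
  have [UVy|nUV] := pselect (((UV i).1 `|` (UV i).2) y); last by left; exists i.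
  by right; exists (N i) => //; rewrite fibN !bigcup_set1.
have sep j : exists U V, separated_by (A j) (B j) U V by exact: closed_pairs_separated.
have pw0 : pairwise (@lex_lt a) w0.
  rewrite pairwise_map; have := iota_ltn_sorted 0 #|I|.
  rewrite (sorted_pairwise ltn_trans); apply: sub_pairwise => k k' kk'.
  by apply/asboolP; right.
have aw0 : all (fun p => ord_rel p.1 x) w0.
  by rewrite all_map; apply/allP => k _ /=; exact: ord_refl.
have [E0|[y nxy covy]] :=
    ind_cover_lt (ind_cover_bigcup (fun i => proj2 (HUV i))).
  exists w0; split=> //; rewrite E0 in step.
  by apply: inessential_off_subset step => // u [i _ <-].
(* Later nodes carry ordinals at most [y], below [x]; put in front of [w0], they keep the list
   increasing. *)
have [w' [pw' aw' iw']] := IH y nxy _ (w0 ++ l) covy A B AB.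
exists (w' ++ w0); split.
- rewrite pairwise_cat pw' pw0 !andbT /allrel; apply: sub_all aw' => p py.
  rewrite /= /w0 all_map; apply/allP => k _ /=; apply/asboolP; left => /= xp.
  by apply: nxy; exact: ord_trans xp py.
- rewrite all_cat aw0 andbT; apply: sub_all aw' => p py.
  exact: ord_trans py (ord_nle nxy).
- apply: inessential_off_subset (inessential_off_comp step iw' _) => //.
    move=> u [[i _ <-]|[[s sE] su]].
      have [[s sE] ?] := Nsuf i; split=> //.
      by exists (w' ++ s); rewrite -!catA sE.
    split; first by exists s; rewrite -catA.
    by apply: leq_ltn_trans su; rewrite size_cat leq_addl.
  rewrite -subset0 => u [[i _ <-] [_]].
  by rewrite size_cat sN sw0 ltn_add2r ltnNge leq_subr.
Qed.

(** * The space *)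

Definition irrational (R : realType) (r : R) : Prop := ~ exists q : rat, r = ratr q.

(* The coordinate [(k, n)] is the [n]-th one of the block [k]; [C] tells which
   pairs of blocks may carry irrational coordinates simultaneously. *)
Definition zpoint (R : realType) (C : rel nat) (x : nat * nat -> R) : Prop :=
  [/\ forall i, 0 <= x i <= 1, finite_set [set i | x i != 0] &
   forall i j, i != j -> irrational (x i) -> irrational (x j) -> C i.1 j.1].

Definition zspace (R : realType) (C : rel nat) := {x : nat * nat -> R | zpoint C x}.

HB.instance Definition _ (R : realType) (C : rel nat) := gen_eqMixin (zspace R C).
HB.instance Definition _ (R : realType) (C : rel nat) := gen_choiceMixin (zspace R C).

Definition zval (R : realType) (C : rel nat) (x : zspace R C) : nat * nat -> R := sval x.

Lemma rational0 (R : realType) : ~ irrational (0 : R).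
Proof. by apply; exists 0; rewrite rmorph0. Qed.

Lemma zpoint0 (R : realType) (C : rel nat) : @zpoint R C (fun=> 0).
Proof.
split=> [i|| i j _ /rational0 //]; first by rewrite lexx ler01.
by apply: sub_finite_set (finite_set0 _) => i /=; rewrite eqxx.
Qed.

Definition zmk (R : realType) (C : rel nat) (x : nat * nat -> R) : zspace R C :=
  if pselect (zpoint C x) is left p then exist _ x p else exist _ _ (zpoint0 R C).

Lemma zmkE (R : realType) (C : rel nat) (x : nat * nat -> R) :
  zpoint C x -> zval (zmk C x) = x.
Proof. by move=> xP; rewrite /zmk; case: pselect. Qed.

Lemma zval_inj (R : realType) (C : rel nat) : injective (@zval R C).
Proof. by move=> [x px] [y py] /= xy; exact: eq_exist. Qed.

Lemma zvalP (R : realType) (C : rel nat) (x : zspace R C) : zpoint C (zval x).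
Proof. exact: svalP. Qed.

Lemma zval_ge0 (R : realType) (C : rel nat) (x : zspace R C) i : 0 <= zval x i.
Proof. by have [/(_ i) /andP[]] := zvalP x. Qed.

Lemma zval_le1 (R : realType) (C : rel nat) (x : zspace R C) i : zval x i <= 1.
Proof. by have [/(_ i) /andP[]] := zvalP x. Qed.

(** Inside a block this is a multiple of the sup metric, so points with a coordinate bounded below
    at escaping places do not accumulate. Across blocks the weights tend to 0, so a ball contains a
    box that constrains only finitely many blocks, and cubes in infinitely many blocks can have a
    compact union. *)
Definition zdist (R : realType) (C : rel nat) (x y : zspace R C) : R :=
  sup (range (fun i => `|zval x i - zval y i| / i.1.+1%:R)).

Lemma zval_dist1 (R : realType) (C : rel nat) (x y : zspace R C) i : `|zval x i - zval y i| <= 1.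
Proof.
rewrite ler_norml; have := zval_ge0 x i; have := zval_ge0 y i.
by have := zval_le1 x i; have := zval_le1 y i; lra.
Qed.

Lemma zdist_weight_le (R : realType) (C : rel nat) (x y : zspace R C) i :
  `|zval x i - zval y i| / i.1.+1%:R <= `|zval x i - zval y i|.
Proof. by rewrite ler_pdivrMr // ler_peMr // ler1n. Qed.

Lemma zdist_coord (R : realType) (C : rel nat) (x y : zspace R C) i :
  `|zval x i - zval y i| / i.1.+1%:R <= zdist x y.
Proof.
apply: ub_le_sup; last by exists i.
exists 1 => _ [j _ <-]; exact: le_trans (zdist_weight_le _ _ _) (zval_dist1 _ _ _).
Qed.

Lemma zdist_le (R : realType) (C : rel nat) (x y : zspace R C) e :
  (forall i, `|zval x i - zval y i| / i.1.+1%:R <= e) -> zdist x y <= e.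
Proof. by move=> xye; apply: ge_sup; [exists (`|zval x (0, 0)%N - zval y (0, 0)%N| / 1%:R); exists (0, 0)%N|move=> _ [i _ <-]]. Qed.

Lemma zdistxx (R : realType) (C : rel nat) (x : zspace R C) : zdist x x = 0.
Proof.
apply/eqP; rewrite eq_le zdist_le => [|i]; last by rewrite subrr normr0 mul0r.
by apply: le_trans (zdist_coord x x (0, 0)%N); rewrite subrr normr0 mul0r.
Qed.

Lemma zdist_eq0 (R : realType) (C : rel nat) (x y : zspace R C) : zdist x y = 0 -> x = y.
Proof.
move=> xy0; apply: zval_inj; apply/funext => i; apply/eqP.
have := zdist_coord x y i; rewrite xy0 ler_pdivrMr // mul0r normr_le0.
by rewrite subr_eq0.
Qed.

Lemma zdistC (R : realType) (C : rel nat) (x y : zspace R C) : zdist x y = zdist y x.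
Proof. by congr sup; apply: eq_imagel => i _; rewrite distrC. Qed.

Lemma zdist_triangle (R : realType) (C : rel nat) (y x z : zspace R C) :
  zdist x z <= zdist x y + zdist y z.
Proof.
apply: zdist_le => i; apply: le_trans (lerD (zdist_coord x y i) (zdist_coord y z i)).
by rewrite -mulrDl ler_pM2r ?invr_gt0 // ler_distD.
Qed.

HB.instance Definition _ (R : realType) (C : rel nat) :=
  @isMetric.Build R (zspace R C) (@zdist R C) (@zdistxx R C) (@zdist_eq0 R C)
    (@zdistC R C) (@zdist_triangle R C).

Lemma zval_dist (R : realType) (C : rel nat) (x y : zspace R C) i :
  `|zval x i - zval y i| <= i.1.+1%:R * mdist x y.
Proof. by rewrite mulrC -ler_pdivrMr //; exact: zdist_coord. Qed.

Lemma mdist_zspace_le (R : realType) (C : rel nat) (x y : zspace R C) e :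
  (forall i, `|zval x i - zval y i| <= e) -> mdist x y <= e.
Proof.
by move=> xye; apply: zdist_le => i; exact: le_trans (zdist_weight_le _ _ _) (xye i).
Qed.

Lemma mdist_zspace_trunc (R : realType) (C : rel nat) (x y : zspace R C) e K :
  K.+1%:R^-1 <= e -> (forall i, (i.1 <= K)%N -> `|zval x i - zval y i| <= e) ->
  mdist x y <= e.
Proof.
move=> Ke xye; apply: zdist_le => i; have [iK|Ki] := leqP i.1 K.
  exact: le_trans (zdist_weight_le _ _ _) (xye i iK).
apply: le_trans Ke; rewrite -[leRHS]mul1r ler_pM ?invr_ge0 ?zval_dist1 //.
by rewrite lef_pV2 ?posrE ?ltr0n // ler_nat ltnS ltnW.
Qed.

(** By the first hypothesis coordinatewise convergence on [E] is metric convergence: blocks past [K]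
    weigh little, and in the others finitely many coordinates vary. The second hypothesis provides
    the limit. *)
Lemma zspace_compact (R : realType) (C : rel nat) (E : set (zspace R C)) :
  (forall K, exists D : seq (nat * nat), forall i x y, (i.1 <= K)%N -> i \notin D ->
     E x -> E y -> zval x i = zval y i) ->
  (forall g : nat * nat -> R,
     (forall (s : seq (nat * nat)) e, 0 < e ->
        exists2 x, E x & forall i, i \in s -> `|zval x i - g i| < e) ->
     exists2 z, E z & zval z = g) ->
  compact E.
Proof.
move=> Efin Ecl; rewrite compact_ultra => F FU FE.
have FF : ProperFilter F by exact: ultra_proper.
(* The limit of the [i]-th coordinate along the ultrafilter is the supremum of its eventual lower
   bounds. *)
pose S i := [set t : R | F [set x | t <= zval x i]].
pose g i := sup (S i).
have S0 i : S i 0 by apply: (filterS _ filterT) => x _; exact: zval_ge0.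
have S1 i : ubound (S i) 1.
  by move=> t /filter_ex [x /= tx]; exact: le_trans tx (zval_le1 x i).
have Fg i e : 0 < e -> F [set x | `|zval x i - g i| < e].
  move=> e0; have [|t St te] := @sup_adherent R (S i) e e0.
    by split; [exists 0|exists 1].
  have : ~ S i (g i + e / 2).
    move=> /(ub_le_sup (ex_intro _ 1 (S1 i))).
    by apply/negP; rewrite -ltNge ltrDl divr_gt0.
  move=> nS; have {nS} : F (~` [set x | g i + e / 2 <= zval x i]).
    by have [|//] := in_ultra_setVsetC [set x | g i + e / 2 <= zval x i] FU.
  rewrite -/(g i) in te; apply: filterS2 St => x /= tx /negP; rewrite -ltNge => xg.
  by rewrite ltr_norml; move: te tx xg; lra.
have Fgs (s : seq (nat * nat)) e : 0 < e ->
    F [set x | forall i, i \in s -> `|zval x i - g i| < e].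
  move=> e0; elim: s => [|i s IH]; first by apply: (filterS _ filterT).
  apply: filterS2 IH (Fg i e e0) => x xs xi j; rewrite inE => /orP[/eqP ->//|].
  exact: xs.
have [s e e0|z Ez zg] := Ecl g.
  by have [x [xs Ex]] := filter_ex (filterI (Fgs s e e0) FE); exists x.
exists z; split=> // A /mdist_nbhsP [e e0 eA].
have e20 : 0 < e / 2 by rewrite divr_gt0.
have [K _ /(_ K (leqnn K)) /= Ke] := natSinv_near e20.
have [D HD] := Efin K; apply: filterS2 (Fgs D _ e20) FE => x xD Ex; apply: eA.
rewrite (@le_lt_trans _ _ (e / 2)) ?gtr_pMr ?invf_lt1 ?ltr1n //.
apply: (mdist_zspace_trunc (ltW Ke)) => i iK.
have [iD|iD] := boolP (i \in D); last by rewrite (HD i x z) // subrr normr0 ltW.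
by rewrite distrC zg ltW // xD.
Qed.

Lemma zsupport (R : realType) (C : rel nat) (x : zspace R C) :
  exists s : seq (nat * nat), forall i, i \notin s -> zval x i = 0.
Proof.
have [_ /finite_seqP[s sE] _] := zvalP x; exists s => i.
by apply: contraNeq => xi; have : [set` s] i by rewrite -sE.
Qed.

Lemma zspace_finite_supp (R : realType) (x : nat * nat -> R) (s : seq (nat * nat)) :
  (forall i, i \notin s -> x i = 0) -> finite_set [set i | x i != 0].
Proof.
move=> xs; apply: sub_finite_set (finite_seq s) => i /=.
by apply: contraNT => /xs ->.
Qed.

Definition assoc_rat (d : seq ((nat * nat) * rat)) (i : nat * nat) : rat :=
  nth 0 (unzip2 d) (index i (unzip1 d)).

Lemma assoc_rat_map (s : seq (nat * nat)) (q : nat * nat -> rat) i :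
  assoc_rat [seq (j, q j) | j <- s] i = if i \in s then q i else 0.
Proof.
rewrite /assoc_rat /unzip1 /unzip2 -!map_comp map_id.
have [si|si] := boolP (i \in s).
  by rewrite (nth_map i) ?index_mem // nth_index.
by rewrite nth_default // size_map leqNgt index_mem.
Qed.

Lemma assoc_rat_out d i : i \notin unzip1 d -> assoc_rat d i = 0.
Proof.
move=> id; have sE : size (unzip2 d) = size (unzip1 d) by rewrite !size_map.
by rewrite /assoc_rat nth_default // sE leqNgt index_mem.
Qed.

Lemma zrational_approx (R : realType) (C : rel nat) (x : zspace R C) (e : R) : 0 < e ->
  exists y : zspace R C, [/\ forall i, zval x i = 0 -> zval y i = 0,
    forall i, exists q : rat, zval y i = ratr q &
    forall i, `|zval x i - zval y i| <= e].
Proof.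
move=> e0.
have /choice[q Hq] i : exists q : rat, [/\ zval x i = 0 -> q = 0, 0 <= (ratr q : R) <= 1 &
    `|zval x i - ratr q| <= e].
  have [x0|x0] := eqVneq (zval x i) 0.
    by exists 0; rewrite x0 rmorph0 subrr normr0 lexx ler01 ltW.
  have xi0 : 0 < zval x i by rewrite lt_neqAle eq_sym x0 zval_ge0.
  have [|q] := @rat_in_itvoo R (Num.max 0 (zval x i - e)) (zval x i).
    by rewrite gt_max xi0 /= gtrBl.
  rewrite in_itv /= gt_max => /andP[/andP[q0 qe] qx]; exists q; split.
  - by move=> xi; rewrite xi ltxx in xi0.
  - by rewrite (ltW q0) (le_trans (ltW qx)) // zval_le1.
  - by rewrite ler_norml; move: qe qx; lra.
have yP : zpoint C (fun i => ratr (q i) : R).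
  split=> [i||i j _ []]; last by exists (q i).
    by case: (Hq i).
  have [s xs] := zsupport x; apply: (@zspace_finite_supp _ _ s) => i /xs xi.
  by case: (Hq i) => /(_ xi) ->; rewrite rmorph0.
exists (zmk C (fun i => ratr (q i))); rewrite (zmkE yP); split=> i.
- by move=> xi; case: (Hq i) => /(_ xi) ->; rewrite rmorph0.
- by exists (q i).
- by case: (Hq i).
Qed.

Lemma zspace_separable (R : realType) (C : rel nat) : separable (zspace R C).
Proof.
pose pt d := zmk C (fun i => ratr (assoc_rat d i) : R).
exists (range pt).
  exact: card_le_trans (card_image_le _ _) (countableP _).
move=> O [x Ox] /mdist_openP/(_ x Ox)[e e0 xeO].
have [|y [xy yq xye]] := @zrational_approx _ _ x (e / 2); first by rewrite divr_gt0.
exists y; split.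
  apply: xeO; apply: le_lt_trans (mdist_zspace_le xye) _.
  by rewrite gtr_pMr // invf_lt1 // ltr1n.
have /choice[q qE] := yq; have [s ys] := zsupport y.
exists [seq (i, q i) | i <- s] => //; apply: zval_inj; rewrite zmkE.
  apply/funext => i; rewrite assoc_rat_map; case: ifP => [_|/negbT /ys ->]; first by rewrite qE.
  by rewrite rmorph0.
rewrite (_ : (fun _ => _) = zval y); first exact: zvalP.
apply/funext => i; rewrite assoc_rat_map; case: ifP => [_|/negbT /ys ->]; first by rewrite qE.
by rewrite rmorph0.
Qed.

Definition zlimit (R : realType) (C : rel nat) (E : set (zspace R C)) (g : nat * nat -> R) :=
  forall (s : seq (nat * nat)) e, 0 < e ->
    exists2 x, E x & forall i, i \in s -> `|zval x i - g i| < e.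

Lemma zlimit_itv (R : realType) (C : rel nat) (E : set (zspace R C)) g i a b :
  zlimit E g -> (forall x, E x -> a <= zval x i <= b) -> a <= g i <= b.
Proof.
move=> gE Eab; apply/andP; split; apply/ler_addgt0Pl => e e0;
  have [x /Eab /andP[ax xb] /(_ i (mem_head _ _))] := gE [:: i] e e0;
  by rewrite ltr_norml; move: ax xb => ? ? /andP[? ?]; lra.
Qed.

Lemma zlimit_eq (R : realType) (C : rel nat) (E : set (zspace R C)) g i c :
  zlimit E g -> (forall x, E x -> zval x i = c) -> g i = c.
Proof.
move=> gE Ec; apply/eqP; rewrite eq_le andbC; apply: (zlimit_itv gE) => x /Ec ->.
by rewrite lexx.
Qed.

Lemma zlimit_neq0 (R : realType) (C : rel nat) (E : set (zspace R C)) g i j :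
  zlimit E g -> g i != 0 -> g j != 0 -> exists x, [/\ E x, zval x i != 0 & zval x j != 0].
Proof.
move=> gE gi gj.
have [|x Ex xg] := gE [:: i; j] (Num.min `|g i| `|g j|).
  by rewrite lt_min !normr_gt0 gi.
exists x; split=> //; apply/eqP => x0.
  have := xg i; rewrite !inE eqxx x0 sub0r normrN lt_min ltxx => /(_ isT) //.
have := xg j; rewrite !inE eqxx orbT x0 sub0r normrN lt_min ltxx andbF => /(_ isT) //.
Qed.

(** The piece [E S d] takes its coordinates off [S] from the rational table [d]; those in [S] run
    over [0, 1], which stays in the space because [S] is [free]. A point lies in a piece where [S]
    lists its irrational coordinates. *)
Lemma zspace_sigma_compact (R : realType) (C : rel nat) : sigma_compact (zspace R C).
Proof.
pose free (S : seq (nat * nat)) := forall i j, i \in S -> j \in S -> i != j -> C i.1 j.1.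
pose E S d := [set x : zspace R C | free S /\
  forall i, i \notin S -> zval x i = ratr (assoc_rat d i)].
have cE S d : compact (E S d).
  apply: zspace_compact => [K|g gE].
    by exists S => i x y _ iS [_ xE] [_ yE]; rewrite xE // yE.
  have [x0 [fS _] _] := gE [::] 1 ltr01.
  have gS i : i \notin S -> g i = ratr (assoc_rat d i).
    by move=> iS; apply: (zlimit_eq gE) => x [_ /(_ i iS)].
  have gP : zpoint C g.
    split=> [i||i j ij gi gj].
    - by apply: (zlimit_itv gE) => x _; rewrite zval_ge0 zval_le1.
    - apply: (@zspace_finite_supp _ _ (S ++ unzip1 d)) => i.
      rewrite mem_cat negb_or => /andP[iS id].
      by rewrite gS // assoc_rat_out // rmorph0.
    - have irrS k : irrational (g k) -> k \in S.
        by move=> gk; apply: contraT => kS; case: gk; exists (assoc_rat d k); rewrite gS.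
      by apply: fS => //; exact: irrS.
  by exists (zmk C g); [split=> // i /gS|]; rewrite (zmkE gP).
exists (fun n => if unpickle n is Some Sd then E Sd.1 Sd.2 else set0).
  by move=> n; case: unpickle => [Sd|]; [exact: cE|exact: compact0].
apply/seteqP; split=> // x _; have [s xs] := zsupport x.
pose S := [seq i <- s | `[< irrational (zval x i) >]].
have /choice[q Hq] i : exists q : rat, ~ irrational (zval x i) -> zval x i = ratr q.
  have [ix|/contrapT [q xq]] := pselect (irrational (zval x i)); last by exists q.
  by exists 0 => /(_ ix).
exists (pickle (S, [seq (i, q i) | i <- s])) => //=; rewrite pickleK /=; split.
  move=> i j; rewrite !mem_filter => /andP[/asboolP xi _] /andP[/asboolP xj _] ij.
  by have [_ _] := zvalP x; apply.
move=> i; rewrite mem_filter assoc_rat_map negb_and.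
case: ifP => [_|/negbT is_ _]; last by rewrite xs // rmorph0.
by rewrite orbF => /asboolPn; exact: Hq.
Qed.

(** * The upper bound for ind *)

Lemma avoid_sequence (R : realType) (u : nat -> R) (a b : R) : a < b ->
  exists x, a < x < b /\ forall n, x != u n.
Proof.
move=> ab.
(* Each step keeps an outer third that misses [u n]; starting from the middle third keeps the limit
   off [a] and [b]. *)
pose step n (p : R * R) := if u n <= (p.1 + p.2) / 2
  then ((p.1 + 2 * p.2) / 3, p.2) else (p.1, (2 * p.1 + p.2) / 3).
pose I := fix I n := if n is m.+1 then step m (I m) else ((2 * a + b) / 3, (a + 2 * b) / 3).
have lt12 n : (I n).1 < (I n).2.
  by elim: n => [|n IH] /=; [lra|rewrite /step; case: ifP => _ /=; lra].
have mono n : (I n).1 <= (I n.+1).1 /\ (I n.+1).2 <= (I n).2.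
  by have := lt12 n; rewrite /= /step; case: ifP => _ /=; lra.
have monoD n m : (I n).1 <= (I (n + m)%N).1 /\ (I (n + m)%N).2 <= (I n).2.
  elim: m => [|m [IH1 IH2]]; rewrite ?addn0 ?addnS; first by rewrite !lexx.
  by have [h1 h2] := mono (n + m)%N; rewrite (le_trans IH1 h1) (le_trans h2 IH2).
have cross n m : (I n).1 <= (I m).2.
  have [h1 _] := monoD n m; have [_ h2] := monoD m n; rewrite addnC in h2.
  exact: le_trans h1 (le_trans (ltW (lt12 _)) h2).
pose x := sup (range (fun n => (I n).1)).
have xlo n : (I n).1 <= x.
  by apply: ub_le_sup; [exists (I 0%N).2 => _ [m _ <-]|exists n].
have xhi n : x <= (I n).2.
  by apply: ge_sup => [|_ [m _ <-] //]; exists (I 0%N).1; exists 0%N.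
exists x; split; first by have := xlo 0%N; have := xhi 0%N; rewrite /=; lra.
move=> n; apply/eqP => xn; have := xlo n.+1; have := xhi n.+1; have := lt12 n.
by rewrite /= /step xn; case: ifPn => /=; rewrite -?ltNge; lra.
Qed.

Lemma uniform_slack (R : realType) (I : eqType) (s : seq I) (f : I -> R) (P : pred I) (e : R) :
  0 < e -> (forall i, P i -> f i < e) ->
  exists r, [/\ 0 < r, r <= e & forall i, i \in s -> P i -> f i <= e - r].
Proof.
move=> e0 fe; elim: s => [|i s [r [r0 re IH]]]; first by exists e.
have [Pi|nPi] := boolP (P i); last first.
  exists r; split=> // k; rewrite inE => /orP[/eqP ->|/IH //].
  by rewrite (negPf nPi).
exists (Num.min r (e - f i)); split.
- by rewrite lt_min r0 subr_gt0 fe.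
- by rewrite ge_min re.
- move=> k; rewrite inE => /orP[/eqP -> _|ks Pk].
    by rewrite lerBrDr -lerBrDl ge_min lexx orbT.
  by apply: le_trans (IH k ks Pk) _; rewrite lerD2l lerN2 ge_min lexx.
Qed.

(** The spaces met in the induction are nested frontiers, bare topological spaces, so distances are
    measured in [Z]. *)
Definition embedding_into (R : realType) (X : topologicalType) (Z : metricType R) (j : X -> Z) :=
  continuous j /\ forall x (V : set X), nbhs x V ->
    exists2 e : R, 0 < e & forall y, mdist (j x) (j y) < e -> V y.

Lemma embedding_subset (R : realType) (X : topologicalType) (Z : metricType R) (j : X -> Z)
  (A : set X) : embedding_into j -> embedding_into (j \o (set_val : A -> X)).
Proof.
move=> [cj ej]; split.
  by move=> x; apply: continuous_comp; [exact: initial_continuous|exact: cj].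
move=> x V [W [[O oO <-] /= Ox OV]].
have [e e0 He] := ej (set_val x) O (open_nbhs_nbhs (conj oO Ox)).
by exists e => // y /He Oy; exact: OV.
Qed.

Lemma embedding_closure (R : realType) (X : topologicalType) (Z : metricType R) (j : X -> Z)
    (U : set X) x : continuous j -> closure U x ->
  forall e : R, 0 < e -> exists2 y, U y & mdist (j x) (j y) < e.
Proof.
move=> cj clx e e0; have [|y [Uy xy]] := clx (j @^-1` [set y | mdist (j x) y < e]).
  apply: cj; apply: open_nbhs_nbhs; split; first exact: mdist_ball_open.
  by rewrite /= mdistxx.
by exists y.
Qed.

(* The boundary of a box whose faces avoid the countable set [range u] consists
   of points having one more coordinate off [range u]; adding the faces to [u]
   uses up the block of that coordinate. *)
Lemma zspace_ind_le (R : realType) (C : rel nat) (Th : ordnum) (rho : seq nat -> Th) :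
  irreflexive C ->
  (forall k s, pairwise C (k :: s) -> ~ ord_rel (rho s) (rho (k :: s))) ->
  forall (th : Th) (X : topologicalType) (j : X -> zspace R C) (u : nat -> R) (F : seq (seq nat)),
  embedding_into j -> (forall q : rat, exists n, u n = ratr q) ->
  (forall kp, kp \in F -> ord_rel (rho kp) th) ->
  (forall x, exists2 kp, kp \in F & pairwise C kp /\
     forall i, ~ range u (zval (j x) i) -> pairwise C (i.1 :: kp)) ->
  ind_le X (Some (iseg th)).
Proof.
move=> Cirr rho_lt; elim/ordP_ind => th IH X j u F jemb ratu Fth FX.
have [cj ej] := jemb.
apply: ind_le_ord => x0 V oV Vx0.
have [e e0 eV] := ej x0 V (open_nbhs_nbhs (conj oV Vx0)).
have e20 : 0 < e / 2 by rewrite divr_gt0.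
have [K _ /(_ K (leqnn K)) /= Ke] := natSinv_near e20.
pose p := zval (j x0); have [s ps] := zsupport (j x0).
(* The centre has finite support, so a box of one radius has only finitely many face values. *)
pose vs := 0 :: map p s.
have pvs i : p i \in vs.
  have [si|/ps pi0] := boolP (i \in s); first by rewrite inE map_f ?orbT.
  by rewrite inE /p pi0 eqxx.
(* The radii for which a face value [v + r] or [v - r] would be a term of [u]. The default 0 is
   harmless, as [r] is positive. *)
pose bad n : R := if @unpickle (nat * nat * bool)%type n is Some (m, k, b) then
  (if b then u m - vs`_k else vs`_k - u m) else 0.
have [r [/andP[r0 re] rbad]] := avoid_sequence bad e20.
have ru b m v : v \in vs -> (if b then v + r else v - r) != u m.
  move=> vvs; apply/eqP => E; have := rbad (pickle (m, index v vs, b)).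
  rewrite /bad pickleK nth_index // => /eqP; apply.
  by case: b E => <- /=; ring.
(* Past block [K] the weight alone keeps points close. With [K] finite, the used-up block has
   finitely many candidates, so [F'] is finite and its ranks have a maximum. *)
pose U := [set x | forall i, (i.1 <= K)%N -> `|zval (j x) i - p i| < r].
have oU : open U.
  rewrite openE => x Ux; have [s' xs'] := zsupport (j x).
  (* Off both supports the differences are 0, so infinitely many strict inequalities reduce to
     finitely many. *)
  have [d [d0 dr Hd]] := @uniform_slack R _ (s ++ s') (fun i => `|zval (j x) i - p i|)
    (fun i => (i.1 <= K)%N) r r0 Ux.
  have dK0 : 0 < d / K.+1%:R by rewrite divr_gt0.
  have : nbhs x (j @^-1` [set y | mdist (j x) y < d / K.+1%:R]).
    apply: cj; apply: open_nbhs_nbhs; split; first exact: mdist_ball_open.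
    by rewrite /= mdistxx.
  apply: filterS => y /= xy i iK; have xyd : `|zval (j x) i - zval (j y) i| < d.
    apply: le_lt_trans (zval_dist _ _ _) _.
    apply: (@le_lt_trans _ _ (K.+1%:R * mdist (j x) (j y))).
      by rewrite ler_wpM2r ?mdist_ge0 // ler_nat.
    by rewrite mulrC -ltr_pdivlMr.
  rewrite distrC in xyd.
  have xp : `|zval (j x) i - p i| <= r - d.
    have [iss|] := boolP (i \in s ++ s'); first exact: Hd.
    rewrite mem_cat negb_or => /andP[/ps pi0 /xs' xi0].
    by rewrite /p pi0 xi0 subrr normr0 subr_ge0.
  apply: (le_lt_trans (ler_distD (zval (j x) i) _ _)).
  by rewrite -[X in _ < X](subrK d) addrC ler_ltD.
have clU x i : closure U x -> (i.1 <= K)%N -> `|zval (j x) i - p i| <= r.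
  move=> clx iK; apply/ler_addgt0Pl => d d0.
  have [|y Uy xy] := embedding_closure cj clx (e := d / i.1.+1%:R); first by rewrite divr_gt0.
  apply: (le_trans (ler_distD (zval (j y) i) _ _)); apply: lerD; last exact/ltW/Uy.
  apply: (le_trans (zval_dist _ _ _)); rewrite mulrC -ler_pdivlMr //.
  exact: ltW.
pose w := [seq v + r | v <- vs] ++ [seq v - r | v <- vs].
pose u' n := if (n < size w)%N then w`_n else u (n - size w)%N.
have u'w v : v \in w -> range u' v.
  by move=> vw; exists (index v w) => //; rewrite /u' index_mem vw nth_index.
have u'u n : range u' (u n).
  by exists (n + size w)%N => //; rewrite /u' addnK ltnNge leq_addl.
have frU x : frontier U x -> exists i, [/\ (i.1 <= K)%N, ~ range u (zval (j x) i) & range u' (zval (j x) i)].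
  move=> [clx nUx]; have [i iK xir] : exists2 i, (i.1 <= K)%N & `|zval (j x) i - p i| = r.
    apply: contrapT => nex; apply: nUx; rewrite (interior_id _).1 // => i iK.
    rewrite lt_neqAle clU // andbT; apply/eqP => xr; apply: nex; by exists i.
  have [b xiE] : exists b : bool, zval (j x) i = if b then p i + r else p i - r.
    have [h|h] := leP 0 (zval (j x) i - p i).
      by exists true; rewrite -xir ger0_norm // addrC subrK.
    by exists false; rewrite -xir ltr0_norm // opprK addrC subrK.
  exists i; split=> //; first by move=> [n _ E]; have := ru b n _ (pvs i); rewrite E -xiE eqxx.
  apply: u'w; rewrite xiE mem_cat; case: b {xiE}; apply/orP; [left|right];
    by apply/mapP; exists (p i).
pose F' := [seq ks <- [seq k :: kp | k <- iota 0 K.+1, kp <- F] | pairwise C ks].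
(* The coordinate [i] on a face is off [u] but in [u']. A coordinate still off [u'] is another
   irrational one, so its block is joined to that of [i], which can join the used blocks. *)
have frF (x : frontier U) : exists2 kp, kp \in F' & pairwise C kp /\
    forall i, ~ range u' (zval (j (set_val x)) i) -> pairwise C (i.1 :: kp).
  have [i [iK nui u'i]] := frU _ (set_valP x).
  have [kp kpF [ckp Hkp]] := FX (set_val x); have cikp := Hkp i nui.
  exists (i.1 :: kp); first by rewrite mem_filter cikp; apply/allpairsP; exists (i.1, kp); rewrite mem_iota.
  split=> // i' nu'i'; have nui' : ~ range u (zval (j (set_val x)) i').
    by move=> [n _ E]; apply: nu'i'; rewrite -E.
  have := Hkp i' nui'; rewrite /= => /andP[-> ckp']; rewrite andbT ckp' andbT.
  have irr k : ~ range u (zval (j (set_val x)) k) -> irrational (zval (j (set_val x)) k).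
    by move=> nk [q kq]; apply: nk; have [n nq] := ratu q; exists n => //; rewrite kq.
  have [_ _ xC] := zvalP (j (set_val x)); rewrite /= in cikp.
  case/andP: cikp => -> _; rewrite !andbT; apply: xC; [|exact: irr|exact: irr].
  by apply/eqP => E; apply: nu'i'; rewrite E.
have F'lt kp : kp \in F' -> ~ ord_rel th (rho kp).
  rewrite mem_filter => /andP[cl /allpairsP[[k kp'] /= [_ kpF E]]]; rewrite {}E in cl *.
  by move=> h; apply: (rho_lt k kp' cl); exact: ord_trans (Fth _ kpF) h.
have [d [dth Fd]] : exists d, dim_lt d (Some (iseg th)) /\ ind_le (frontier U : Type) d.
  case: (F') F'lt frF => [|kp0 F''] F'lt frF.
    exists None; split; first by split=> // [[]].
    by apply: ind_le_empty; rewrite -subset0 => x _; have [] := frF x.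
  have [i0 i0max] := fin_ord_max (fun i : 'I_(size (kp0 :: F'')) => rho (nth [::] (kp0 :: F'') i)) ord0.
  pose th' := rho (nth [::] (kp0 :: F'') i0).
  have nth' : ~ ord_rel th th' by apply: F'lt; rewrite mem_nth.
  exists (Some (iseg th')); split; first exact: dim_lt_iseg.
  apply: (IH th' nth' _ (j \o set_val) u' (kp0 :: F'')).
  - exact: embedding_subset.
  - by move=> q; have [n <-] := ratu q; have [m _ mE] := u'u n; exists m.
  - move=> kp kpF; have kpi : (index kp (kp0 :: F'') < size (kp0 :: F''))%N by rewrite index_mem.
    by have := i0max (Ordinal kpi); rewrite /= nth_index.
  - exact: frF.
exists U, d; split=> //.
- by move=> i iK; rewrite subrr normr0.
- move=> x Ux; apply: eV; apply: (@le_lt_trans _ _ (e / 2)); last first.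
    by rewrite gtr_pMr // invf_lt1 // ltr1n.
  apply: (mdist_zspace_trunc (ltW Ke)) => i iK; rewrite distrC.
  exact: le_trans (ltW (Ux i iK)) (ltW re).
Qed.

Lemma zspace_ind (R : realType) (C : rel nat) (Th : ordnum) (rho : seq nat -> Th) :
  irreflexive C ->
  (forall k s, pairwise C (k :: s) -> ~ ord_rel (rho s) (rho (k :: s))) ->
  ind_le (zspace R C) (Some (iseg (rho [::]))).
Proof.
move=> Cirr rho_lt.
apply: (@zspace_ind_le R C Th rho Cirr rho_lt _ _ id
  (fun n => if @unpickle rat n is Some q then ratr q else 0) [:: [::]]).
- split=> [x //|x V /mdist_nbhsP [e e0 xV]]; by exists e.
- by move=> q; exists (pickle q); rewrite pickleK.
- by move=> kp; rewrite inE => /eqP ->; exact: ord_refl.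
- by move=> x; exists [::]; rewrite ?inE.
Qed.

(** * Closed mappings *)

(** A point of the closure has finite support, so in block [k] it vanishes from some index on and
    keeps distance [d / k.+1] from all but finitely many terms. *)
Lemma escaping_closed (R : realType) (C : rel nat) (z : nat -> zspace R C) (k : nat)
    (e : nat -> nat) (d : R) :
  0 < d -> (forall m, (m <= e m)%N) -> (forall m, d <= zval (z m) (k, e m)) ->
  closed (range z).
Proof.
move=> d0 me zd; apply/closure_id/seteqP; split; first exact: subset_closure.
move=> x /mdist_closureP clx; have [s xs] := zsupport x.
pose M := (\max_(i <- s) i.2).+1.
have xM n : (M <= n)%N -> zval x (k, n) = 0.
  move=> Mn; apply: xs; apply/negP => ks; move: Mn; rewrite ltnNge => /negP; apply.
  exact: (leq_bigmax_seq (k, n) ks).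
have far m : (M <= m)%N -> d / k.+1%:R <= mdist x (z m).
  move=> Mm; rewrite ler_pdivrMr // mulrC.
  apply: le_trans (zval_dist x (z m) (k, e m)).
  by rewrite xM ?(leq_trans Mm) // sub0r normrN ger0_norm ?zval_ge0.
apply: contrapT => nx.
have [r [r0 rd Hr]] : exists r : R, [/\ 0 < r, r <= d / k.+1%:R &
    forall m, (m < M)%N -> r <= mdist x (z m)].
  elim: (M) => [|M' [r [r0 rd IH]]]; first by exists (d / k.+1%:R); rewrite divr_gt0.
  have xz0 : 0 < mdist x (z M') by rewrite mdist_gt0; apply/eqP => E; apply: nx; exists M'.
  exists (Num.min r (mdist x (z M'))); split; rewrite ?lt_min ?r0 ?ge_min ?rd // => m.
  by rewrite ltnS leq_eqVlt ge_min => /predU1P[->|/IH ->//]; rewrite lexx orbT.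
have [_ [m _ <-] xm] := clx r r0.
have [mM|Mm] := ltnP m M; first by have := Hr m mM; rewrite leNgt xm.
by have := le_trans rd (far m Mm); rewrite leNgt xm.
Qed.

Lemma escaping_image (R : realType) (C : rel nat) (Y : metricType R) (f : zspace R C -> Y)
    (z : nat -> zspace R C) (k : nat) (e : nat -> nat) (d : R) (y : Y) :
  closed_mapping f -> 0 < d -> (forall m, (m <= e m)%N) ->
  (forall m, d <= zval (z m) (k, e m)) -> (forall m, f (z m) <> y) ->
  ~ (forall r, 0 < r -> exists m, mdist y (f (z m)) < r).
Proof.
move=> [_ clf] d0 me zd nfy near.
have cR := clf _ (escaping_closed d0 me zd).
have ny : ~ (f @` range z) y by move=> [_ [m _ <-] /nfy].
have [r r0 Hr] := not_closed_mdist cR ny.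
by have [m /Hr] := near r r0; apply; exists (z m) => //; exists m.
Qed.

Definition zset (R : realType) (C : rel nat) (x : zspace R C) (i : nat * nat) (t : R) : zspace R C :=
  zmk C (fun j => if j == i then t else zval x j).

Definition zfree (R : realType) (C : rel nat) (x : zspace R C) (i : nat * nat) : Prop :=
  forall j, j != i -> irrational (zval x j) -> C i.1 j.1.

Lemma zset_point (R : realType) (C : rel nat) (x : zspace R C) i t :
  symmetric C -> 0 <= t <= 1 -> zfree x i \/ ~ irrational t ->
  zpoint C (fun j => if j == i then t else zval x j).
Proof.
move=> Csym t01 fr; have [s xs] := zsupport x; split=> [j||j l].
- by case: eqP => // _; rewrite zval_ge0 zval_le1.
- apply: (@zspace_finite_supp _ _ (i :: s)) => j; rewrite inE negb_or => /andP[/negPf -> /xs //].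
- have [_ _ xC] := zvalP x; case: (eqVneq j i) => [->|ji]; case: (eqVneq l i) => [->|li].
  + by [].
  + by move=> _ it il; case: fr => // fr; exact: fr.
  + by move=> _ ij it; rewrite Csym; case: fr => // fr; exact: fr.
  + exact: xC.
Qed.

Lemma zsetE (R : realType) (C : rel nat) (x : zspace R C) i t :
  symmetric C -> 0 <= t <= 1 -> zfree x i \/ ~ irrational t ->
  zval (zset x i t) = (fun j => if j == i then t else zval x j).
Proof. by move=> Csym t01 fr; rewrite zmkE //; exact: zset_point. Qed.

(** An irrational coordinate is free, the other irrational ones being joined to it; if there is none
    in [s], every coordinate in [s] is free. *)
Lemma zfree_exists (R : realType) (C : rel nat) (x : zspace R C) (s : seq (nat * nat)) i0 :
  (forall i, i \notin i0 :: s -> zval x i = 0) -> ~ irrational (zval x i0) -> s != [::] ->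
  exists2 i, i \in s & zfree x i.
Proof.
move=> xs ri0 s0.
have [[i is_ ii]|nirr] := pselect (exists2 i, i \in s & irrational (zval x i)).
  exists i => // j ji ij; have [_ _ xC] := zvalP x; apply: xC => //; by rewrite eq_sym.
case: s s0 xs nirr => // i s _ xs nirr; exists i; rewrite ?inE ?eqxx // => j _ ij.
have [jis|/xs j0] := boolP (j \in i0 :: i :: s); last by rewrite j0 in ij; case: (rational0 ij).
move: jis; rewrite inE => /predU1P[ji0|js]; first by rewrite ji0 in ij.
by case: nirr; exists j.
Qed.

Lemma interval_clopen (R : realType) (P : R -> Prop) (b : R) : 0 <= b ->
  (forall t, 0 <= t <= b -> exists2 r : R, 0 < r &
     forall s, 0 <= s <= b -> `|s - t| < r -> (P s <-> P t)) ->
  P 0 <-> P b.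
Proof.
move=> b0 loc.
pose S := [set t | 0 <= t <= b /\ forall s, 0 <= s <= t -> (P s <-> P 0)].
have S0 : S 0.
  by split; [rewrite lexx|move=> s; rewrite -eq_le eq_sym => /eqP ->].
have Sb : ubound S b by move=> t [/andP[]].
pose c := sup S.
have c0b : 0 <= c <= b.
  apply/andP; split; first by apply: ub_le_sup S0; exists b.
  by apply: ge_sup => //; exists 0.
have [r r0 Hr] := loc c c0b.
have [|t [/andP[t0 tb] Ht] tc] := @sup_adherent R S r r0; first by split; [exists 0|exists b].
rewrite -/c in tc.
have tlec : t <= c by apply: ub_le_sup; [exists b|split; rewrite ?t0].
have PcP0 : P c <-> P 0.
  rewrite -(Ht t) ?t0 ?lexx //; symmetry; apply: Hr; first by rewrite t0 tb.
  by rewrite ltr_norml; move: tc tlec r0; lra.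
have Sc' u : 0 <= u <= b -> u < c + r -> S u.
  move=> /andP[u0 ub] ucr; split; first by rewrite u0.
  move=> s /andP[s0 su]; have [st|ts] := leP s t; first by apply: Ht; rewrite s0.
  rewrite -PcP0; apply: Hr; first by rewrite s0 (le_trans su ub).
  by rewrite ltr_norml; move: ts su ucr tc; lra.
have cE : c = b.
  apply: contrapT => cb; have cltb : c < b by move: c0b => /andP[c0 cb']; rewrite lt_neqAle cb' andbT; apply/eqP.
  pose u := Num.min b (c + r / 2).
  have cu : c < u by rewrite lt_min cltb ltrDl divr_gt0.
  have : u <= c.
    apply: ub_le_sup; first by exists b.
    apply: Sc'; first by rewrite (le_trans _ (ltW cu)) ?ge_min ?lexx //; case/andP: c0b.
    by rewrite gt_min ltrD2l gtr_pMr // invf_lt1 // ltr1n orbT.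
  by rewrite leNgt cu.
by rewrite -cE; split=> /PcP0.
Qed.

Lemma mdist_continuous (R : realType) (X Y : metricType R) (f : X -> Y) x (r : R) :
  continuous f -> 0 < r ->
  exists2 d : R, 0 < d & forall y, mdist x y < d -> mdist (f x) (f y) < r.
Proof.
move=> cf r0; apply/(@mdist_nbhsP R X x [set y | mdist (f x) (f y) < r]).
by apply: (cf x [set z | mdist (f x) z < r]); apply/mdist_nbhsP; exists r.
Qed.

Lemma zset_dist (R : realType) (C : rel nat) (x : zspace R C) i s t :
  symmetric C -> 0 <= s <= 1 -> 0 <= t <= 1 -> zfree x i \/ (~ irrational s /\ ~ irrational t) ->
  mdist (zset x i s) (zset x i t) <= `|s - t|.
Proof.
move=> Csym s01 t01 fr; apply: mdist_zspace_le => j.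
rewrite !zsetE //; [|by case: fr => [|[]]; auto|by case: fr => [|[]]; auto].
by case: eqP => // _; rewrite subrr normr0.
Qed.

Lemma zset_id (R : realType) (C : rel nat) (x : zspace R C) i :
  symmetric C -> zfree x i \/ ~ irrational (zval x i) -> zset x i (zval x i) = x.
Proof.
move=> Csym fr; apply: zval_inj; rewrite zsetE ?zval_ge0 ?zval_le1 //.
by apply/funext => j; case: eqP => // ->.
Qed.

(* Moves the coordinates to 0 one at a time, the irrational ones first, so that
   the path does not leave the space. *)
Lemma locally_constant_zero (R : realType) (C : rel nat) (P : zspace R C -> Prop)
    (i0 : nat * nat) (d : R) (s : seq (nat * nat)) :
  symmetric C -> ~ irrational d ->
  (forall z, zval z i0 = d -> exists2 r : R, 0 < r & forall w, mdist z w < r -> (P w <-> P z)) ->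
  forall z, zval z i0 = d -> i0 \notin s -> (forall i, i \notin i0 :: s -> zval z i = 0) ->
  P z <-> P (zset (zmk C (fun=> 0)) i0 d).
Proof.
move=> Csym rd loc; have [n] := ubnP (size s); elim: n s => // n IH s sn z zd i0s zs.
have [sE|s0] := eqVneq s [::].
  rewrite sE in zs.
  have -> : z = zset (zmk C (fun=> 0)) i0 d; last by [].
  apply: zval_inj; rewrite zsetE //; [|by rewrite -zd zval_ge0 zval_le1|by right].
  apply/funext => j; rewrite (zmkE (zpoint0 R C)); case: eqP => [-> //|/eqP ji].
  by apply: zs; rewrite inE.
have rzi0 : ~ irrational (zval z i0) by rewrite zd.
have [i is_ fri] := zfree_exists zs rzi0 s0.
have ii0 : i0 != i by apply: contraNneq i0s => ->.
have path01 t : 0 <= t <= zval z i -> 0 <= t <= 1.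
  by move=> /andP[-> ti]; rewrite (le_trans ti) ?zval_le1.
have pathE t : 0 <= t <= zval z i -> zval (zset z i t) = (fun j => if j == i then t else zval z j).
  by move=> /path01 t01; rewrite zsetE //; left.
have -> : P z <-> P (zset z i 0).
  rewrite -{1}(@zset_id _ _ z i Csym); last by left.
  symmetry; apply: (@interval_clopen R (fun t => P (zset z i t))); first exact: zval_ge0.
  move=> t tz; have [|r r0 Hr] := loc (zset z i t); first by rewrite pathE // (negPf ii0).
  exists r => // u uz ut; apply: Hr; apply: le_lt_trans ut; rewrite distrC.
  by apply: zset_dist => //; [exact: path01|exact: path01|left].
have z0 : 0 <= (0 : R) <= zval z i by rewrite lexx zval_ge0.
apply: (IH [seq j <- s | j != i]).
- rewrite -ltnS; apply: leq_trans sn; rewrite ltnS size_filter -(count_predC (fun j => j != i) s).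
  rewrite -addn1 leq_add2l -has_count; apply/hasP; exists i => //=.
  by rewrite negbK.
- by rewrite pathE // (negPf ii0).
- by rewrite mem_filter negb_and i0s orbT.
- move=> j; rewrite pathE // inE negb_or mem_filter negb_and negbK => /andP[ji0].
  by case: eqP => //= ji js; apply: zs; rewrite inE negb_or ji0.
Qed.

Lemma rational_natSinv (R : realType) n : ~ irrational (n.+1%:R^-1 : R).
Proof. by apply; exists n.+1%:R^-1; rewrite fmorphV rmorph_nat. Qed.

(** If a ball around [p] went to [y], every slice with a far coordinate equal to [d] would contain
    fibre points that are limits of points off the fibre. Points off the fibre, one near each slice,
    would escape while their images tend to [y]. *)
Lemma fiber_nowhere_open (R : realType) (C : rel nat) (Y : metricType R) (f : zspace R C -> Y)
    (y : Y) (p : zspace R C) (r : R) :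
  symmetric C -> closed_mapping f -> non_constant f -> 0 < r ->
  exists2 q, mdist p q < r & f q <> y.
Proof.
move=> Csym clf [a [b fab]] r0; have [cf _] := clf.
apply: contrapT => nq; have fy q : mdist p q < r -> f q = y.
  by move=> pq; apply: contrapT => fqy; apply: nq; exists q.
have [q0 fq0] : exists q, f q <> y.
  have [fay|] := pselect (f a = y); last by exists a.
  by exists b => fby; apply: fab; rewrite fay.
have [r' r'0 Hr'] : exists2 r' : R, 0 < r' & forall q, mdist q0 q < r' -> f q <> y.
  have yq0 : 0 < mdist (f q0) y by rewrite mdist_gt0; apply/eqP.
  have [d d0 Hd] := mdist_continuous q0 cf yq0.
  by exists d => // q /Hd /[swap] ->; rewrite ltxx.
have rr0 : 0 < Num.min r r' by rewrite lt_min r0.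
(* The edge value [d] is rational so that it can be put at any coordinate of any point. *)
have [n _ /(_ n (leqnn n)) /=] := natSinv_near rr0.
have := @rational_natSinv R n; have : 0 < n.+1%:R^-1 :> R by rewrite invr_gt0.
have : n.+1%:R^-1 <= 1 :> R by rewrite invf_le1 // ler1n.
move: (n.+1%:R^-1) => d d1 d0 rd; rewrite lt_min => /andP[dr dr'].
have d01 : 0 <= d <= 1 by rewrite ltW.
have [sp psp] := zsupport p; have [sq qsq] := zsupport q0.
pose N := (\max_(i <- sp ++ sq) i.2).+1.
have Nout m : (0%N, (m + N)%N) \notin sp ++ sq.
  apply/negP => ms; have : (m + N <= \max_(i <- sp ++ sq) i.2)%N.
    exact: (leq_bigmax_seq (0%N, (m + N)%N) ms).
  by rewrite leqNgt => /negP; apply; rewrite /N addnS ltnS leq_addl.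
(* Raising [i0] from 0 to [d] moves [p] and [q0] by at most [d], so the slice meets the fibre and
   its complement. By [locally_constant_zero], membership in the fibre is then not locally constant
   along the slice. *)
have bdry m : exists z, [/\ zval z (0%N, (m + N)%N) = d, f z = y &
    forall rho : R, 0 < rho -> exists2 w, mdist z w < rho & f w <> y].
  set i0 := (0%N, _); have := Nout m; rewrite mem_cat negb_or -/i0 => /andP[i0p i0q].
  apply: contrapT => nz.
  have loc z : zval z i0 = d -> exists2 rho : R, 0 < rho &
      forall w, mdist z w < rho -> (f w = y <-> f z = y).
    move=> zd; have [fzy|fzy] := pselect (f z = y).
      apply: contrapT => nrho; apply: nz; exists z; split=> // rho rho0.
      apply: contrapT => nw; apply: nrho; exists rho => // w zw; split=> // _.
      by apply: contrapT => fwy; apply: nw; exists w.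
    have yz0 : 0 < mdist (f z) y by rewrite mdist_gt0; apply/eqP.
    have [rho rho0 Hrho] := mdist_continuous z cf yz0; exists rho => // w /Hrho fzw.
    by split=> // fwy; rewrite fwy ltxx in fzw.
  have tozero x (s : seq (nat * nat)) : (forall i, i \notin s -> zval x i = 0) -> i0 \notin s ->
      f (zset x i0 d) = y <-> f (zset (zmk C (fun=> 0)) i0 d) = y.
    move=> xs i0s; apply: (@locally_constant_zero R C (fun x => f x = y) i0 d s Csym rd loc _ _ i0s).
      by rewrite zsetE ?eqxx //; right.
    move=> i; rewrite inE negb_or => /andP[/negPf ii0 /xs xi0].
    by rewrite zsetE ?ii0 //; right.
  have zset_close (x : zspace R C) : zval x i0 = 0 -> mdist x (zset x i0 d) <= d.
    move=> x0; apply: mdist_zspace_le => i; rewrite zsetE //; last by right.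
    case: eqP => [->|_]; last by rewrite subrr normr0 ltW.
    by rewrite x0 sub0r normrN ger0_norm // ltW.
  have nfq : f (zset q0 i0 d) <> y.
    by apply: Hr'; apply: le_lt_trans (zset_close _ _) dr'; exact: qsq.
  apply: nfq; apply/(tozero q0 sq qsq i0q)/(tozero p sp psp i0p).
  by apply: fy; apply: le_lt_trans (zset_close _ _) dr; exact: psp.
have /choice[w Hw] m : exists w, [/\ d / 2 <= zval w (0%N, (m + N)%N), f w <> y &
    mdist y (f w) < m.+1%:R^-1].
  have [z [zd fzy Hz]] := bdry m.
  have m0 : 0 < m.+1%:R^-1 :> R by rewrite invr_gt0.
  have [rho rho0 Hrho] := mdist_continuous z cf m0.
  have [|w] := Hz (Num.min rho (d / 2)); first by rewrite lt_min rho0 divr_gt0.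
  rewrite lt_min => /andP[zw1 zw2] fwy; exists w; split=> //; last by rewrite -fzy Hrho.
  have := le_lt_trans (zval_dist z w (0%N, (m + N)%N)) _; rewrite mul1r => /(_ _ zw2).
  by rewrite zd ltr_norml => /andP[_]; lra.
apply: (@escaping_image R C Y f w 0%N (fun m => (m + N)%N) (d / 2) y clf).
- by rewrite divr_gt0.
- by move=> m; exact: leq_addr.
- by move=> m; case: (Hw m).
- by move=> m; case: (Hw m).
- move=> e e0; have [m _ /(_ m (leqnn m)) /= me] := natSinv_near e0.
  by exists m; apply: lt_trans me; case: (Hw m).
Qed.

(** Otherwise the images accumulate at some [y]. Moving the terms slightly off the fibre of [y],
    with the escaping coordinate still at least [d / 2], gives a sequence whose images approach [y]
    without reaching it. *)
Lemma escaping_compact (R : realType) (C : rel nat) (Y : metricType R) (f : zspace R C -> Y)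
    (P : set (zspace R C)) (z : nat -> zspace R C) (k : nat) (e : nat -> nat) (d : R) :
  symmetric C -> closed_mapping f -> non_constant f -> compact P ->
  0 < d -> (forall m, (m <= e m)%N) -> (forall m, d <= zval (z m) (k, e m)) ->
  ~ forall m, (f @` P) (f (z m)).
Proof.
move=> Csym clf ncf cP d0 me zd fzP; have [cf _] := clf.
have cfP : compact (f @` P).
  by apply: continuous_compact cP; apply: continuous_subspaceT => x; exact: cf.
have fzP' : ((f \o z) @ \oo) (f @` P) by exists 0%N => // m _; exact: fzP.
have [y [_ cly]] := cfP ((f \o z) @ \oo) _ fzP'.
have sub n (r : R) : 0 < r -> exists2 m, (n <= m)%N & mdist y (f (z m)) < r.
  move=> r0; have [||_ [[m nm <-] yz]] := cly ((f \o z) @` [set m | (n <= m)%N]) [set x | mdist y x < r].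
  - by exists n => // m /= nm; exists m.
  - by apply/mdist_nbhsP; exists r.
  - by exists m.
have /choice[w Hw] n : exists w, exists2 m, (n <= m)%N &
    [/\ d / 2 <= zval w (k, e m), f w <> y & mdist y (f w) < n.+1%:R^-1].
  have n0 : 0 < n.+1%:R^-1 / 2 :> R by rewrite divr_gt0 // invr_gt0.
  have [m nm ym] := sub n _ n0; have [rho rho0 Hrho] := mdist_continuous (z m) cf n0.
  have k0 : 0 < Num.min rho (d / 2 / k.+1%:R) by rewrite lt_min rho0 !divr_gt0.
  have [w] := fiber_nowhere_open y (z m) Csym clf ncf k0.
  rewrite lt_min => /andP[zw1 zw2] fwy; exists w, m => //; split=> //.
    rewrite ltr_pdivlMr // mulrC in zw2.
    have := le_lt_trans (zval_dist (z m) w (k, e m)) zw2; have := zd m.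
    by rewrite ltr_norml => ? /andP[_]; lra.
  rewrite [X in _ < X]splitr; apply: le_lt_trans (metric_triangle _ (f (z m)) _) _.
  by rewrite ltrD // Hrho.
have /choice[m Hm] : forall n, exists m, (n <= m)%N /\ [/\ d / 2 <= zval (w n) (k, e m), f (w n) <> y & mdist y (f (w n)) < n.+1%:R^-1].
  by move=> n; have [m ? ?] := Hw n; exists m.
apply: (@escaping_image R C Y f w k (e \o m) (d / 2) y clf).
- by rewrite divr_gt0.
- by move=> n; apply: leq_trans (me _); case: (Hm n).
- by move=> n; case: (Hm n) => _ [].
- by move=> n; case: (Hm n) => _ [].
- move=> r r0; have [n _ /(_ n (leqnn n)) /= nr] := natSinv_near r0.
  by exists n; apply: lt_trans nr; case: (Hm n) => _ [].
Qed.

(** * Cliques and the cubes over them *)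

Definition no_infinite_clique (C : rel nat) :=
  forall h : nat -> nat, ~ forall a b, a != b -> C (h a) (h b).

(** Along the initial segments of an infinite clique the rank would decrease forever. *)
Lemma rank_no_infinite_clique (C : rel nat) (Th : ordnum) (rho : seq nat -> Th) :
  (forall k s, pairwise C (k :: s) -> ~ ord_rel (rho s) (rho (k :: s))) ->
  no_infinite_clique C.
Proof.
move=> rho_lt h hC; pose s := fix s n := if n is m.+1 then h m :: s m else [::].
have sC n a : (n <= a)%N -> all (C (h a)) (s n).
  elim: n => //= n IH na; rewrite IH ?(ltnW na) // andbT.
  by apply: hC; rewrite gtn_eqF.
have cs n : pairwise C (s n) by elim: n => //= n IH; rewrite IH sC.
have [|x [[n ->] xmin]] := @ord_min Th (fun x => exists n, x = rho (s n)).
  by exists (rho (s 0%N)), 0%N.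
apply: (rho_lt (h n) (s n)); first exact: (cs n.+1).
by apply: xmin; exists n.+1.
Qed.

(* With [g k = (n, d)], the edge of the block [k] is the interval [0, d] on its
   [n]-th coordinate. *)
Definition cube (R : realType) (C : rel nat) (g : nat -> nat * R) (P : set nat) : set (zspace R C) :=
  [set x | [/\ forall i, zval x i != 0 -> P i.1 /\ i.2 = (g i.1).1,
     forall k, P k -> zval x (k, (g k).1) <= (g k).2 &
     forall i j, i != j -> zval x i != 0 -> zval x j != 0 -> C i.1 j.1]].

Definition low_face (R : realType) (C : rel nat) (g : nat -> nat * R) (P : set nat) k : set (zspace R C) :=
  [set x | cube g P x /\ zval x (k, (g k).1) = 0].

Definition high_face (R : realType) (C : rel nat) (g : nat -> nat * R) (P : set nat) k : set (zspace R C) :=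
  [set x | cube g P x /\ zval x (k, (g k).1) = (g k).2].

(** Each block contributes a single coordinate, as [zspace_compact] requires. A coordinatewise limit
    could leave the space only by having infinite support, and this would be an infinite clique. *)
Lemma cube_sub_compact (R : realType) (C : rel nat) (g : nat -> nat * R) (P : set nat)
    (E : set (zspace R C)) :
  no_infinite_clique C -> E `<=` cube g P ->
  (forall h x, zlimit E h -> zval x = h -> cube g P x -> E x) -> compact E.
Proof.
move=> nC Ecube Ecl.
have out x i : E x -> i.2 != (g i.1).1 -> zval x i = 0.
  by move=> /Ecube [xs _ _]; apply: contraNeq => /xs [_ ->].
apply: zspace_compact => [K|h hE].
  exists [seq (k, (g k).1) | k <- iota 0 K.+1] => i x y iK iD Ex Ey.
  have ig : i.2 != (g i.1).1.
    apply: contraNneq iD => ig; apply/mapP; exists i.1; first by rewrite mem_iota.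
    by rewrite -ig; case: i {iK ig}.
  by rewrite !out.
have hC i j : i != j -> h i != 0 -> h j != 0 -> C i.1 j.1.
  move=> ij hi hj; have [x [/Ecube [_ _ xC] xi xj]] := zlimit_neq0 hE hi hj.
  exact: xC.
have hP : zpoint C h.
  split=> [i||i j ij hi hj].
  - by apply: (zlimit_itv hE) => x _; rewrite zval_ge0 zval_le1.
  - apply: contrapT => /infiniteP/pcard_leP[u].
    apply: (nC (fun n => (u n).1)) => a b ab.
    have un c : h (u c) != 0 by have /(_ c I) := @funS _ _ _ _ u.
    by apply: hC => //; apply: contraNneq ab => /(@inj _ _ _ u) ->; rewrite ?inE.
  - apply: hC => //; apply/eqP => h0; [move: hi|move: hj]; rewrite h0; exact: rational0.
have cubeh : cube g P (zmk C h).
  split=> [i|k|i j]; rewrite (zmkE hP).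
  - by move=> hi; have [x [/Ecube [xs _ _] /xs]] := zlimit_neq0 hE hi hi.
  - move=> Pk; have /andP[] // : 0 <= h (k, (g k).1) <= (g k).2.
    by apply: (zlimit_itv hE) => x /Ecube [_ xg _]; rewrite zval_ge0 xg.
  - exact: hC.
exists (zmk C h); last exact: zmkE.
by apply: (Ecl h _ hE _ cubeh); exact: zmkE.
Qed.

Lemma cube_compact (R : realType) (C : rel nat) (g : nat -> nat * R) (P : set nat) :
  no_infinite_clique C -> compact (cube g P : set (zspace R C)).
Proof. by move=> nC; apply: (cube_sub_compact (g := g) (P := P) nC). Qed.

Lemma low_face_compact (R : realType) (C : rel nat) (g : nat -> nat * R) (P : set nat) k :
  no_infinite_clique C -> compact (low_face g P k : set (zspace R C)).
Proof.
move=> nC; apply: (cube_sub_compact (g := g) (P := P) nC) => [x []//|h x hE xh xc].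
by split=> //; rewrite xh; apply: (zlimit_eq hE) => y [].
Qed.

Lemma high_face_compact (R : realType) (C : rel nat) (g : nat -> nat * R) (P : set nat) k :
  no_infinite_clique C -> compact (high_face g P k : set (zspace R C)).
Proof.
move=> nC; apply: (cube_sub_compact (g := g) (P := P) nC) => [x []//|h x hE xh xc].
by split=> //; rewrite xh; apply: (zlimit_eq hE) => y [].
Qed.

Lemma compact_closed_apart (R : realType) (Y : metricType R) (A B : set Y) :
  compact A -> closed B -> A `&` B = set0 ->
  exists2 e : R, 0 < e & forall p q, A p -> B q -> e <= mdist p q.
Proof.
move=> cA cB AB.
have [|e e0 He] := compact_uniform (P := fun p e => forall q, B q -> e <= mdist p q) cA _.
  move=> p Ap; have nBp : ~ B p by move=> Bp; have : (A `&` B) p by []; rewrite AB.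
  have [e e0 He] := not_closed_mdist cB nBp.
  exists (e / 2); first by rewrite divr_gt0.
  apply/mdist_nbhsP; exists (e / 2); first by rewrite divr_gt0.
  move=> p' pp' r r0 re q Bq; rewrite leNgt; apply/negP => p'q.
  apply: (He q) Bq; apply: le_lt_trans (metric_triangle p p' q) _.
  by rewrite [e]splitr ltrD // (lt_le_trans p'q).
by exists e => // p q Ap Bq; exact: He.
Qed.

Lemma compact_unif_continuous (R : realType) (X Y : metricType R) (A : set X) (f : X -> Y) (e : R) :
  compact A -> continuous f -> 0 < e ->
  exists2 r : R, 0 < r & forall a z, A a -> mdist a z < r -> mdist (f a) (f z) < e.
Proof.
move=> cA cf e0; have e20 : 0 < e / 2 by rewrite divr_gt0.
have [|r r0 Hr] := compact_uniform (P := fun a r => forall z, mdist a z < r -> mdist (f a) (f z) < e) cA _.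
  move=> a Aa; have [d d0 Hd] := mdist_continuous a cf e20.
  exists (d / 2); first by rewrite divr_gt0.
  apply/mdist_nbhsP; exists (d / 2); first by rewrite divr_gt0.
  have d2 : d / 2 <= d by rewrite ler_piMr ?invf_le1 ?ler1n // ltW.
  move=> a' aa' r r0 rd z a'z.
  apply: le_lt_trans (metric_triangle _ (f a) _) _; rewrite [e]splitr ltrD //.
    by rewrite metric_sym Hd // (lt_le_trans aa').
  apply: Hd; apply: le_lt_trans (metric_triangle _ a' _) _.
  by rewrite [d]splitr ltrD // (lt_le_trans a'z).
by exists r => // a z Aa; exact: Hr.
Qed.

Lemma compact_images_apart (R : realType) (X Y : metricType R) (A B : set X) (f : X -> Y) :
  compact A -> compact B -> continuous f -> f @` A `&` f @` B = set0 ->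
  exists2 r : R, 0 < r & forall a b z z', A a -> B b ->
    mdist a z < r -> mdist b z' < r -> f z <> f z'.
Proof.
move=> cA cB cf AB.
have cfA (D : set X) : compact D -> compact (f @` D).
  by move=> cD; apply: continuous_compact cD; apply: continuous_subspaceT => x; exact: cf.
have [e e0 He] := compact_closed_apart (cfA _ cA) (compact_closed_metric (cfA _ cB)) AB.
have e20 : 0 < e / 2 by rewrite divr_gt0.
have [r1 r10 H1] := compact_unif_continuous cA cf e20.
have [r2 r20 H2] := compact_unif_continuous cB cf e20.
exists (Num.min r1 r2) => [|a b z z' Aa Bb]; first by rewrite lt_min r10.
rewrite !lt_min => /andP[/(H1 _ _ Aa) az _] /andP[_ /(H2 _ _ Bb) bz'] E.
have := He (f a) (f b) (imageP f Aa) (imageP f Bb).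
rewrite leNgt => /negP; apply; apply: le_lt_trans (metric_triangle _ (f z) _) _.
by rewrite [e]splitr ltrD // E metric_sym.
Qed.

(** * The choice of the edges, block after block *)

Definition below (n : nat) : set nat := [set k | (k < n)%N].

Definition good_prefix (R : realType) (C : rel nat) (Y : Type) (f : zspace R C -> Y)
    (g : nat -> nat * R) (n : nat) :=
  forall k, (k < n)%N -> 0 < (g k).2 <= 1 /\
    f @` low_face g (below n) k `&` f @` high_face g (below n) k = set0.

Definition extend (T : Type) (g : nat -> T) (n : nat) (p : T) : nat -> T :=
  fun k => if k == n then p else g k.

(** Disjoint compact images stay disjoint when the faces are thickened a little, and finitely many
    faces share one thickness. The next edge is made shorter than it. *)
Lemma low_high_apart (R : realType) (C : rel nat) (Y : metricType R) (f : zspace R C -> Y)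
    (g : nat -> nat * R) (n : nat) :
  no_infinite_clique C -> continuous f -> good_prefix f g n ->
  exists2 r : R, 0 < r & forall k a b z z', (k < n)%N -> low_face g (below n) k a ->
    high_face g (below n) k b -> mdist a z < r -> mdist b z' < r -> f z <> f z'.
Proof.
move=> nC cf gn; suff H m : (m <= n)%N -> exists2 r : R, 0 < r & forall k a b z z', (k < m)%N ->
    low_face g (below n) k a -> high_face g (below n) k b ->
    mdist a z < r -> mdist b z' < r -> f z <> f z' by exact: H.
elim: m => [|m IH] mn; first by exists 1.
have [r r0 Hr] := IH (ltnW mn).
have [r' r'0 Hr'] := compact_images_apart (low_face_compact (g := g) (P := below n) (k := m) nC)
  (high_face_compact (g := g) (P := below n) (k := m) nC) cf (gn m mn).2.
exists (Num.min r r') => [|k a b z z']; first by rewrite lt_min r0.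
rewrite ltnS leq_eqVlt !lt_min => km ka kb /andP[a1 a2] /andP[b1 b2].
case/predU1P: km => [E|km]; last exact: (Hr k a b).
by rewrite E in ka kb; exact: (Hr' a b).
Qed.

(** With [d < r], setting the new coordinate to 0 moves a point by less than [r] into the old cube,
    so the old faces stay apart. For far [N] the image of the new high face misses that of the old
    cube, which contains the new low face. *)
Lemma good_prefix_extend (R : realType) (C : rel nat) (Y : metricType R) (f : zspace R C -> Y)
    (g : nat -> nat * R) (n : nat) :
  symmetric C -> no_infinite_clique C -> closed_mapping f -> non_constant f ->
  good_prefix f g n -> exists p, good_prefix f (extend g n p) n.+1.
Proof.
move=> Csym nC clf ncf gn; have [cf _] := clf.
have [r r0 Hr] := low_high_apart nC cf gn.
have [m _ /(_ m (leqnn m)) /=] := natSinv_near r0.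
have : 0 < m.+1%:R^-1 :> R by rewrite invr_gt0.
have : m.+1%:R^-1 <= 1 :> R by rewrite invf_le1 // ler1n.
move: (m.+1%:R^-1) => d d1 d0 dr.
have extn p k : (k < n)%N -> extend g n p k = g k.
  by move=> kn; rewrite /extend ltn_eqF.
have ext_n p : extend g n p n = p by rewrite /extend eqxx.
(* If every [N] failed, points of the high faces would form an escaping sequence with images in a
   compact image, against [escaping_compact]. *)
have [N HN] : exists N, forall x, high_face (extend g n (N, d)) (below n.+1) n x ->
    ~ (f @` cube g (below n)) (f x).
  apply: contrapT => nN.
  have /choice[x Hx] N : exists x, high_face (extend g n (N, d)) (below n.+1) n x /\
      (f @` cube g (below n)) (f x).
    by apply: contrapT => nx; apply: nN; exists N => x hx fx; apply: nx; exists x.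
  apply: (escaping_compact (P := cube g (below n)) (z := x) (k := n) (e := id) (d := d)
    Csym clf ncf (cube_compact (g := g) (P := below n) nC)) => // N; last by case: (Hx N).
  by have [[_]] := Hx N; rewrite ext_n => ->.
pose g' := extend g n (N, d); exists (N, d).
have sup' (x : zspace R C) i : cube g' (below n.+1) x -> zval x i != 0 ->
    i = (n, N) \/ (i.1 < n)%N /\ i.2 = (g i.1).1.
  move=> [xs _ _] /xs [/=]; rewrite /below /= ltnS leq_eqVlt => /predU1P[E|lt] ig.
    by left; move: ig; rewrite E /g' ext_n; case: i E => i1 i2 /= -> ->.
  by right; move: ig; rewrite /g' extn.
pose z0 (x : zspace R C) := zset x (n, N) 0.
have z0E (x : zspace R C) : zval (z0 x) = fun i => if i == (n, N) then 0 else zval x i.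
  by rewrite /z0 zsetE ?lexx ?ler01 //; right; exact: rational0.
have z0cube x : cube g' (below n.+1) x -> cube g (below n) (z0 x).
  move=> xc; have [xs xg xC] := xc; split=> [i|k|i j ij].
  - rewrite z0E; case: (i =P (n, N)) => [_ /eqP //|ni].
    by move=> /(sup' _ _ xc) [].
  - move=> kn; rewrite z0E xpair_eqE ltn_eqF //= -(extn (N, d) k kn).
    by apply: xg; exact: ltnW.
  - by rewrite z0E; case: (i =P (n, N)) => [_ /eqP //|_]; case: (j =P (n, N)) => [_ _ /eqP //|_]; exact: xC.
have z0near x : cube g' (below n.+1) x -> mdist (z0 x) x < r.
  move=> [_ xg _]; apply: le_lt_trans dr; apply: mdist_zspace_le => i.
  rewrite z0E; case: eqP => [->|_]; last by rewrite subrr normr0 ltW.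
  rewrite sub0r normrN ger0_norm ?zval_ge0 //.
  by have := xg n (ltnSn n); rewrite /g' ext_n.
have z0k x k : (k < n)%N -> zval (z0 x) (k, (g k).1) = zval x (k, (g' k).1).
  by move=> kn; rewrite z0E xpair_eqE ltn_eqF //= /g' extn.
move=> k; rewrite ltnS leq_eqVlt => /predU1P[->|kn].
  split; first by rewrite ext_n /= d0 d1.
  rewrite -subset0 => y [[a [ac a0] fa] [b hb fb]].
  apply: (HN b hb); exists a; last by rewrite fa fb.
  have a0' : z0 a = a.
    move: a0; rewrite ext_n /= => a0; rewrite /z0 -a0 zset_id //; right.
    by rewrite a0; exact: rational0.
  by rewrite -a0'; exact: z0cube.
split; first by rewrite extn //; case: (gn k kn).
rewrite -subset0 => y [[a [ac a0] fa] [b [bc b1] fb]].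
apply: (Hr k (z0 a) (z0 b) a b kn _ _ (z0near a ac) (z0near b bc)); last by rewrite fa fb.
- by split; [exact: z0cube|rewrite z0k].
- by split; [exact: z0cube|rewrite z0k // b1 /g' extn].
Qed.

Lemma low_face_ext (R : realType) (C : rel nat) (g g' : nat -> nat * R) (n k : nat) :
  (forall m, (m < n)%N -> g m = g' m) -> (k < n)%N ->
  low_face g (below n) k `<=` (low_face g' (below n) k : set (zspace R C)) /\
  high_face g (below n) k `<=` (high_face g' (below n) k : set (zspace R C)).
Proof.
move=> gg' kn; have cc : cube g (below n) `<=` (cube g' (below n) : set (zspace R C)).
  move=> x [xs xg xC]; split=> // [i /xs [Pi ->]|m mn]; first by rewrite gg'.
  by rewrite -gg' //; exact: xg.
by split=> x [/cc xc xk]; split=> //; rewrite -gg'.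
Qed.

Lemma good_prefix_ext (R : realType) (C : rel nat) (Y : Type) (f : zspace R C -> Y)
    (g g' : nat -> nat * R) (n : nat) :
  (forall m, (m < n)%N -> g m = g' m) -> good_prefix f g n -> good_prefix f g' n.
Proof.
move=> gg' gn k kn; have [gk fk] := gn k kn; split; first by rewrite -gg'.
have g'g m : (m < n)%N -> g' m = g m by move=> /gg'.
have [lo hi] := @low_face_ext R C g' g n k g'g kn.
rewrite -subset0 -fk => y [[a /lo la fa] [b /hi hb fb]].
by split; [exists a|exists b].
Qed.

Lemma cube_restrict (R : realType) (C : rel nat) (g : nat -> nat * R) (n : nat) (x : zspace R C) :
  cube g setT x -> (forall i, zval x i != 0 -> (i.1 < n)%N) -> cube g (below n) x.
Proof.
move=> [xs xg xC] xn; split=> // [i xi|k _]; last exact: xg.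
by split; [exact: xn|case: (xs i xi)].
Qed.

Lemma zval_block_bound (R : realType) (C : rel nat) (x : zspace R C) :
  exists n, forall i, zval x i != 0 -> (i.1 < n)%N.
Proof.
have [s xs] := zsupport x; exists (\max_(i <- s) i.1).+1 => i xi; rewrite ltnS.
have is_ : i \in s by apply: contraNT xi => /xs ->.
exact: (leq_bigmax_seq i is_).
Qed.

(** Edges once chosen never change, so [g k] is read off at stage [k.+1]. Two face points with a
    common image have finite support and thus already lie in the faces of a finite stage. *)
Lemma faces_exist (R : realType) (C : rel nat) (Y : metricType R) (f : zspace R C -> Y) :
  symmetric C -> no_infinite_clique C -> closed_mapping f -> non_constant f ->
  exists g : nat -> nat * R, forall k, 0 < (g k).2 <= 1 /\
    f @` low_face g setT k `&` f @` high_face g setT k = set0.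
Proof.
move=> Csym nC clf ncf.
have /choice[F HF] (ng : nat * (nat -> nat * R)) : exists p,
    good_prefix f ng.2 ng.1 -> good_prefix f (extend ng.2 ng.1 p) ng.1.+1.
  have [gn|ngn] := pselect (good_prefix f ng.2 ng.1); last by exists (0%N, 0).
  by have [p] := good_prefix_extend Csym nC clf ncf gn; exists p.
pose G := fix G n := if n is m.+1 then extend (G m) m (F (m, G m)) else fun=> (0%N, 0 : R).
have Ggood n : good_prefix f (G n) n by elim: n => [|n IH] // ; exact: (HF (n, G n)).
have Gstable n m k : (k < n)%N -> G (n + m)%N k = G n k.
  move=> kn; elim: m => [|m IH]; first by rewrite addn0.
  by rewrite addnS /= /extend ltn_eqF // (leq_trans kn) // leq_addr.
pose g k := G k.+1 k; have gG n k : (k < n)%N -> G n k = g k.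
  by move=> kn; rewrite -(subnKC kn) Gstable.
have ggood n : good_prefix f g n by apply: good_prefix_ext (Ggood n) => m; exact: gG.
exists g => k; have [gk _] := ggood k.+1 k (ltnSn k); split=> //.
rewrite -subset0 => y [[a [ac a0] fa] [b [bc b1] fb]].
have [na Hna] := zval_block_bound a; have [nb Hnb] := zval_block_bound b.
pose n := maxn k.+1 (maxn na nb).
have [_ fn] := ggood n k (leq_maxl _ _); rewrite -fn; split.
- exists a => //; split=> //; apply: cube_restrict => // i /Hna ina.
  by rewrite (leq_trans ina) // /n !leq_max leqnn !orbT.
- exists b => //; split=> //; apply: cube_restrict => // i /Hnb inb.
  by rewrite (leq_trans inb) // /n !leq_max leqnn !orbT.
Qed.

(** * Grids in a cube and essential faces *)

Lemma pairwise_clique (C : rel nat) (s : seq nat) a b :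
  symmetric C -> pairwise C s -> a \in s -> b \in s -> a != b -> C a b.
Proof.
move=> Csym; elim: s => //= k s IH /andP[/allP ks cs]; rewrite !inE.
move=> /predU1P[->|as_] /predU1P[->|bs] ab; rewrite ?eqxx // in ab *.
- exact: ks.
- by rewrite Csym; exact: ks.
- exact: IH.
Qed.

(** Grid points scaled to the edges of the blocks in [s]. The cut-off [minn] is needed because the
    labelling theorem takes labels on all of [I -> nat]. *)
Definition grid_coord (R : realType) (g : nat -> nat * R) (s : seq nat) (n : nat)
    (x : 'I_(size s) -> nat) (i : nat * nat) : R :=
  if i.2 == (g i.1).1 then
    if insub (index i.1 s) is Some o then (g i.1).2 * ((minn (x o) n)%:R / n%:R) else 0
  else 0.

Lemma grid_coord_block (R : realType) (g : nat -> nat * R) (s : seq nat) (n : nat)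
    (x : 'I_(size s) -> nat) (o : 'I_(size s)) (k : nat) : uniq s -> k = nth 0%N s o ->
  grid_coord g n x (k, (g k).1) = (g k).2 * ((minn (x o) n)%:R / n%:R).
Proof.
move=> us ->; rewrite /grid_coord eqxx /= index_uniq // insubT //=.
by move=> lt; congr (_ * ((minn (x _) _)%:R / _)); exact: val_inj.
Qed.

Lemma grid_coord_neq0 (R : realType) (g : nat -> nat * R) (s : seq nat) (n : nat)
    (x : 'I_(size s) -> nat) (i : nat * nat) : grid_coord g n x i != 0 ->
  i.2 = (g i.1).1 /\ i.1 \in s.
Proof.
rewrite /grid_coord; case: (i.2 =P _) => [->|_]; last by rewrite eqxx.
by case: insubP => [o|]; [rewrite index_mem|rewrite eqxx].
Qed.

Lemma grid_coord_itv (R : realType) (g : nat -> nat * R) (s : seq nat) (n : nat)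
    (x : 'I_(size s) -> nat) (i : nat * nat) : (forall k, 0 < (g k).2) ->
  0 <= grid_coord g n.+1 x i <= (g i.1).2.
Proof.
move=> g0; have gi := ltW (g0 i.1); rewrite /grid_coord.
case: ifP => _; last by rewrite lexx.
case: insub => [o|]; last by rewrite lexx.
apply/andP; split; first by rewrite mulr_ge0 // divr_ge0.
rewrite ler_piMr // ler_pdivrMr // mul1r ler_nat.
exact: geq_minr.
Qed.

Lemma grid_point_cube (R : realType) (C : rel nat) (g : nat -> nat * R) (s : seq nat) (n : nat)
    (x : 'I_(size s) -> nat) : symmetric C -> pairwise C s -> (forall k, 0 < (g k).2 <= 1) ->
  zpoint C (grid_coord g n.+1 x) /\ cube g setT (zmk C (grid_coord g n.+1 x)).
Proof.
move=> Csym cs g01; have g0 k : 0 < (g k).2 by case/andP: (g01 k).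
have xC i j : i != j -> grid_coord g n.+1 x i != 0 -> grid_coord g n.+1 x j != 0 -> C i.1 j.1.
  move=> ij /grid_coord_neq0 [i2 is_] /grid_coord_neq0 [j2 js].
  apply: (pairwise_clique Csym cs) => //; apply: contraNneq ij => E.
  by rewrite [i]surjective_pairing [j]surjective_pairing i2 j2 E.
have xP : zpoint C (grid_coord g n.+1 x).
  split=> [i||i j ij xi xj].
  - have /andP[-> xg] := grid_coord_itv n x i g0; rewrite (le_trans xg) //.
    by case/andP: (g01 i.1).
  - apply: (@zspace_finite_supp _ _ [seq (k, (g k).1) | k <- s]) => i.
    apply: contraNeq => /grid_coord_neq0 [i2 is_]; apply/mapP; exists i.1 => //.
    by rewrite -i2; case: (i).
  - by apply: xC => //; apply/eqP => E; [move: xi|move: xj]; rewrite E; exact: rational0.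
split=> //; split=> [i|k _|i j]; rewrite (zmkE xP); last exact: xC.
- by move=> /grid_coord_neq0 [].
- by case/andP: (grid_coord_itv n x (k, (g k).1) g0).
Qed.

Lemma grid_point_dist (R : realType) (C : rel nat) (g : nat -> nat * R) (s : seq nat) (n : nat)
    (x z : 'I_(size s) -> nat) : symmetric C -> pairwise C s -> (forall k, 0 < (g k).2 <= 1) ->
  in_cell [set: 'I_(size s)]%SET x z ->
  mdist (zmk C (grid_coord g n.+1 x)) (zmk C (grid_coord g n.+1 z)) <= n.+1%:R^-1.
Proof.
move=> Csym cs g01 xz; apply: mdist_zspace_le => i.
have [xP _] := grid_point_cube n x Csym cs g01.
have [zP _] := grid_point_cube n z Csym cs g01.
rewrite !zmkE // /grid_coord; case: ifP => _; last by rewrite subrr normr0 invr_ge0.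
case: insub => [o|]; last by rewrite subrr normr0 invr_ge0.
have /andP[g0 g1] := g01 i.1.
rewrite -mulrBr normrM ger0_norm ?(ltW g0) // -[leRHS]mul1r.
apply: ler_pM => //; first exact: ltW.
rewrite -mulrBl normrM [X in _ * X]ger0_norm ?invr_ge0 // ler_piMl ?invr_ge0 //.
rewrite distrC; have /andP[h1 h2] := xz o; rewrite !inE in h2.
have m1 : (minn (x o) n.+1 <= minn (z o) n.+1)%N by lia.
by rewrite -natrB // normr_nat lern1; lia.
Qed.

(** Pulled back along [f], the separating sets cover the union of cubes, so the vertices of a fine
    grid cell lie in one of them. Labelling by absence from [U k] gives a cell with both labels for
    every [k], which fits into no [U k] and no [V k]. *)
Lemma cube_essential (R : realType) (C : rel nat) (Y : metricType R) (f : zspace R C -> Y)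
    (g : nat -> nat * R) (s : seq nat) :
  symmetric C -> irreflexive C -> no_infinite_clique C -> continuous f ->
  (forall k, 0 < (g k).2 <= 1) -> pairwise C s ->
  ~ inessential_off (fun k => f @` low_face g setT k) (fun k => f @` high_face g setT k)
      [set` s] set0 (f @` cube g setT).
Proof.
move=> Csym Cirr nC cf g01 cs [U [V [sUV cov]]].
have us : uniq s.
  by rewrite uniq_pairwise; apply: sub_pairwise cs => a b; apply: contraTneq => ->; rewrite Cirr.
pose nd (o : 'I_(size s)) := nth 0%N s o.
have nds o : nd o \in s by exact: mem_nth.
pose O (u : 'I_(size s) * bool) := f @^-1` (if u.2 then U (nd u.1) else V (nd u.1)).
have [||d d0 Hd] := @lebesgue_number R (zspace R C) (cube g setT) _ O (cube_compact nC).
- move=> [o b]; have [oU oV _ _ _] := sUV (nd o) (nds o).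
  by rewrite /O /=; apply: open_comp => [x _|]; [exact: cf|case: b].
- move=> x Lx; have [//|[k /= ks UVk]] := cov (f x) (imageP f Lx).
  have ik : (index k s < size s)%N by rewrite index_mem.
  case: UVk => h; [exists (Ordinal ik, true)|exists (Ordinal ik, false)];
    by rewrite /O /nd /= nth_index.
have [n _ /(_ n (leqnn n)) /= nd_] := natSinv_near d0.
pose pt (x : 'I_(size s) -> nat) := zmk C (grid_coord g n.+1 x).
pose lab o x := `[< ~ U (nd o) (f (pt x)) >].
have ptE x : zval (pt x) = grid_coord g n.+1 x.
  by rewrite zmkE //; case: (grid_point_cube n x Csym cs g01).
have ptL x : cube g setT (pt x) by case: (grid_point_cube n x Csym cs g01).
have [||x [_ Hx]] := @discrete_poincare_miranda _ n.+1 lab.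
- move=> o x xo; apply/asboolP => -[]; have [_ _ AU _ _] := sUV (nd o) (nds o).
  apply: AU; exists (pt x) => //; split=> //.
  by rewrite ptE (@grid_coord_block R g s n.+1 x o _ us) // xo min0n mul0r mulr0.
- move=> o x xo; apply/asboolP => Ux; have [_ _ _ BV UV] := sUV (nd o) (nds o).
  have : (U (nd o) `&` V (nd o)) (f (pt x)); last by rewrite UV.
  split=> //; apply: BV; exists (pt x) => //; split=> //.
  by rewrite ptE (@grid_coord_block R g s n.+1 x o _ us) // xo minnn divff ?mulr1 // pnatr_eq0.
have [[o b] Hob] := Hd _ (ptL x).
have cellO z : in_cell [set: 'I_(size s)]%SET x z -> O (o, b) (pt z).
  by move=> xz; apply: Hob; apply: le_lt_trans nd_; exact: grid_point_dist.
have [z [z' [xz xz' labz labz']]] := Hx o.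
move/asboolP: labz => /contrapT Uz; move/asboolP: labz' => nUz'.
have := cellO z xz; have := cellO z' xz'; rewrite /O /=; case: b {Hob cellO} => // _ Vz.
have [_ _ _ _ UV] := sUV (nd o) (nds o).
by have : (U (nd o) `&` V (nd o)) (f (pt z)) by []; rewrite UV.
Qed.

(** * Cliques of blocks and their ranks *)

Definition lex_rel (a b : ordnum) : rel (a * b) := fun p q =>
  ~~ ord_rel q.1 p.1 || (`[< p.1 = q.1 >] && ord_rel p.2 q.2).

Lemma lex_rel_wo (a b : ordnum) : well_order (@lex_rel a b).
Proof.
apply: antisymmetric_well_order => [[x y] [x' y']|A [[x0 y0] A0]].
  rewrite /lex_rel /= => /andP[/orP[x'x|/andP[/asboolP <- yy']]].
    move=> /orP[xx'|/andP[/asboolP E _]].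
      by have [h|h] := ord_total x x'; [move: xx'|move: x'x]; rewrite h.
    by move: x'x; rewrite E ord_refl.
  rewrite ord_refl /= => /andP[_ y'y]; congr (_, _); exact: ord_antisym.
have [|x [[y Ay] xmin]] := @ord_min a (fun x => exists y, (x, y) \in A).
  by exists x0, y0.
have [|z [Az zmin]] := @ord_min b (fun y => (x, y) \in A); first by exists y.
exists (x, z); split=> // -[x' y'] A'; rewrite /lex_rel /=.
have xx' : ord_rel x x' by apply: xmin; exists y'.
have [x'x|//] := boolP (ord_rel x' x); have E := ord_antisym xx' x'x.
by rewrite asboolT //= zmin // E.
Qed.

Definition ord_lex (a b : ordnum) : ordnum := OrdNum (@lex_rel_wo a b).

(** [None] is the head of the empty list, from which the rank has to descend. *)
Definition top_rel (a : ordnum) : rel (option a) := fun x y =>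
  match x, y with
  | _, None => true
  | None, Some _ => false
  | Some x, Some y => ord_rel x y
  end.

Lemma top_rel_wo (a : ordnum) : well_order (@top_rel a).
Proof.
apply: antisymmetric_well_order => [[x|] [y|] //= /andP[xy yx]|A [x0 A0]].
  by rewrite (ord_antisym xy yx).
have [[x Ax]|nA] := pselect (exists x, Some x \in A).
  have [|y [Ay ymin]] := @ord_min a (fun x => Some x \in A); first by exists x.
  by exists (Some y); split=> // -[z|] Az //=; exact: ymin.
exists None; split=> [|[z|] Az //]; last by case: nA; exists z.
by case: x0 A0 => // x Ax; case: nA; exists x.
Qed.

Definition ord_top (a : ordnum) : ordnum := OrdNum (@top_rel_wo a).

Lemma leq_wo : well_order leq.
Proof.
apply: antisymmetric_well_order => [m n /anti_leq //|A [n An]].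
have [|m Am mmin] := @ex_minnP (fun m => m \in A); first by exists n.
by exists m.
Qed.

Definition ord_nat : ordnum := OrdNum (@leq_wo).

Lemma ord_nat_iseg_finite (n : ord_nat) : ord_finite (iseg n).
Proof.
rewrite /ord_finite; pose v (y : iseg n) : nat := sval y.
have -> : [set: iseg n] = v @^-1` `I_n.
  by apply/seteqP; split=> // -[y yn] _ /=; rewrite /v /= ltnNge.
by apply: finite_preimage; [move=> y z _ _; exact: val_inj|exact: finite_II].
Qed.

Lemma ord_finite_le (a b : ordnum) : ord_le a b -> ord_finite b -> ord_finite a.
Proof.
move=> [f [fr _]]; rewrite /ord_finite -(preimage_setT f); apply: finite_preimage.
by move=> x y _ _ fxy; apply: ord_antisym; rewrite -fr fxy ord_refl.
Qed.

Lemma is_suffix_size (T : Type) (u v : seq T) : is_suffix u v -> (size u <= size v)%N.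
Proof. by move=> [s ->]; rewrite size_cat leq_addl. Qed.

Lemma is_suffix_eq (T : Type) (u v : seq T) : is_suffix u v -> size u = size v -> u = v.
Proof.
move=> [[|x s] ->] //; rewrite size_cat /= => /eqP.
by rewrite eqn_leq addSn ltnNge leq_addl andbF.
Qed.

(* Blocks are the strictly increasing lists over [alpha * nat], head smallest,
   and a clique is a set of suffixes of one list. *)
Definition list_compatible (a : ordnum) (u v : seq (a * nat)) : bool :=
  `[< [/\ u <> v, pairwise (@lex_lt a) u, pairwise (@lex_lt a) v &
      is_suffix u v \/ is_suffix v u] >].

Definition longest (T B : Type) (g : T -> seq B) : seq T -> seq B :=
  foldr (fun k l => if (size l < size (g k))%N then g k else l) [::].

Lemma longest_size (T : eqType) (B : Type) (g : T -> seq B) s k :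
  k \in s -> (size (g k) <= size (longest g s))%N.
Proof.
elim: s => //= m s IH; rewrite inE => /predU1P[->|/IH le].
  by case: ltnP.
by case: ltnP => // lt; exact: leq_trans le (ltnW lt).
Qed.

Lemma longest_mem (T : eqType) (B : Type) (g : T -> seq B) s :
  longest g s = [::] \/ exists2 k, k \in s & longest g s = g k.
Proof.
elim: s => [|m s IH]; first by left.
rewrite /=; case: ltnP => _; first by right; exists m; rewrite ?inE ?eqxx.
by case: IH => [|[k ks ->]]; [left|right; exists k; rewrite // inE ks orbT].
Qed.

Lemma lex_lt_rel (a : ordnum) (p q : a * nat) : lex_lt p q ->
  @lex_rel a ord_nat p q /\ p <> q.
Proof.
move=> /asboolP [npq|[pq1 pq2]]; split.
- by apply/orP; left; apply/negP.
- by move=> E; apply: npq; rewrite E ord_refl.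
- by apply/orP; right; rewrite asboolT //=; exact: ltnW.
- by move=> E; rewrite E ltnn in pq2.
Qed.

(** When a clique grows, either its longest list gets longer, hence a smaller head, or it stays.
    Then the second component drops: it counts the sizes not yet taken, from 0 to that of the
    longest list, hence [.+1]. *)
Definition list_rank (a : ordnum) (g : nat -> seq (a * nat)) (s : seq nat) :
    ord_lex (ord_top (ord_lex a ord_nat)) ord_nat :=
  (ohead (longest g s), (size (longest g s)).+1 - size s)%N.

Lemma list_rank_lt (a : ordnum) (g : nat -> seq (a * nat)) k s :
  pairwise (fun k l => list_compatible (g k) (g l)) (k :: s) ->
  ~ ord_rel (list_rank g s) (list_rank g (k :: s)).
Proof.
move=> cks; rewrite /list_rank /=; set l := longest g s; case: ltnP => [lt|ge].
  case gk : (g k) lt => [//|p t] lt.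
  suff [pl nlp] : @top_rel (ord_lex a ord_nat) (Some p) (ohead l) /\ ohead l <> Some p.
    move=> /orP[/negP []//|/andP[/asboolP /= E _]].
    exact: nlp.
  case lE : l lt => [|q l'] lt; first by split.
  have [lm|[m ms lm]] := longest_mem g s; rewrite -/l lE in lm => //.
  have /allP/(_ m ms)/asboolP : all (fun l => list_compatible (g k) (g l)) s.
    by case/andP: cks.
  rewrite gk -lm => -[_ pk _ [/is_suffix_size|[[|p' s'] E]]].
  - by rewrite leqNgt lt.
  - by move: lt; rewrite E ltnn.
  - case: E => _ E2; have : lex_lt p q.
      move: pk; rewrite E2 /= => /andP[+ _]; rewrite all_cat /= => /and3P[_ + _].
      by [].
    move=> /lex_lt_rel [pq npq]; split=> // -[qp]; exact: npq.
move=> /orP[/negP|/andP[_ /=]]; first by apply; exact: ord_refl.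
rewrite /ord_rel /= => le.
(* Compatible lists differ in size, so at most [(size l).+1] fit below the longest one, and the
   truncated subtraction really decreases. *)
have szE u v : list_compatible u v -> size u != size v.
  move=> /asboolP [uv _ _ suf]; apply/eqP => E; apply: uv.
  by case: suf => h; [exact: is_suffix_eq|symmetry; exact: is_suffix_eq].
have : (size [seq size (g m) | m <- k :: s] <= size (iota 0 (size l).+1))%N.
  apply: uniq_leq_size.
    rewrite uniq_pairwise pairwise_map; apply: sub_pairwise cks => u v; exact: szE.
  move=> n /mapP[m]; rewrite inE => /predU1P[->|ms] ->; rewrite mem_iota /= add0n ltnS //.
  exact: longest_size.
by rewrite size_map size_iota /=; lia.
Qed.

(** The dimension argument indexes pairs by ordinals or lists, the space by block numbers. *)
Lemma inessential_off_reindex (Y : topologicalType) (J J' : Type) (h : J -> J') (g : J' -> J)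
    (A B : J' -> set Y) (P : set J) (P' : set J') (Q T : set Y) :
  (forall k, P' k -> P (g k) /\ h (g k) = k) -> (forall j, P j -> P' (h j) /\ g (h j) = j) ->
  inessential_off (A \o h) (B \o h) P Q T -> inessential_off A B P' Q T.
Proof.
move=> gP hP [U [V [sUV cov]]]; exists (U \o g), (V \o g); split=> [k P'k|y /cov [Qy|[j Pj UVj]]].
- by have [Pgk hgk] := gP k P'k; have := sUV _ Pgk; rewrite /= hgk.
- by left.
- by have [P'hj ghj] := hP j Pj; right; exists (h j); rewrite //= ghj.
Qed.

(** * Reduction of the theorem to properties of the graph *)

Definition detects_ind (R : realType) (C : rel nat) (alpha : ordnum) :=
  forall (Y : metricType R) (A B : nat -> set Y) (K : set Y) (x : alpha),
    closed_pairs A B -> ind_image K (Some (iseg x)) ->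
    exists2 s, pairwise C s & inessential_off A B [set` s] set0 K.

Lemma zspace_closed_images (R : realType) (C : rel nat) (alpha : ordnum) (x0 : alpha)
    (Y : metricType R) (f : zspace R C -> Y) :
  symmetric C -> irreflexive C -> no_infinite_clique C -> detects_ind R C alpha ->
  closed_mapping f -> non_constant f ->
  exists K : set Y, [/\ K `<=` range f, compact K &
    (exists2 d, ind_eq (K : Type) d & dim_le (Some alpha) d) \/ ~ has_ind (K : Type)].
Proof.
move=> Csym Cirr nC det clf ncf; have [cf _] := clf.
have [g Hg] := faces_exist Csym nC clf ncf.
have cimg (D : set (zspace R C)) : compact D -> compact (f @` D).
  by move=> cD; apply: continuous_compact cD; apply: continuous_subspaceT => x; exact: cf.
pose K := f @` cube g setT; have cK : compact K by apply: cimg; exact: cube_compact.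
exists K; split=> //; first by move=> _ [x _ <-]; exists x.
apply: (ind_ge_or_undefined x0) => x Kx.
have [k||s cs ess] := det Y (fun k => f @` low_face g setT k) (fun k => f @` high_face g setT k) K x.
- split; last by case: (Hg k).
  + by apply: compact_closed_metric; apply: cimg; exact: low_face_compact.
  + by apply: compact_closed_metric; apply: cimg; exact: high_face_compact.
- exists (K : Type), set_val; split=> //.
  + exact: compact_set_type.
  + exact: initial_continuous.
  + apply/seteqP; split=> [_ [y _ <-]|y Ky]; first exact: set_valP.
    by exists (exist _ y (mem_set Ky)).
- by apply: (cube_essential Csym Cirr nC cf _ cs ess) => k; case: (Hg k).
Qed.

Lemma zspace_witness (R : realType) (C : rel nat) (alpha Th : ordnum) (rho : seq nat -> Th) :
  alpha -> symmetric C -> irreflexive C ->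
  (forall k s, pairwise C (k :: s) -> ~ ord_rel (rho s) (rho (k :: s))) ->
  detects_ind R C alpha -> (ord_finite alpha -> ord_finite (iseg (rho [::]))) ->
  exists Z : metricType R,
    [/\ separable Z, sigma_compact Z, exists x y : Z, x <> y,
        exists2 zeta : ordnum, ind_eq Z (Some zeta) & (ord_finite alpha -> ord_finite zeta)
      & forall (Y : metricType R) (f : Z -> Y),
          separable Y -> closed_mapping f -> non_constant f ->
          exists K : set Y,
            [/\ K `<=` range f, compact K
              & (exists2 d : option ordnum, ind_eq (K : Type) d & dim_le (Some alpha) d)
                \/ ~ has_ind (K : Type)]].
Proof.
move=> x0 Csym Cirr rho_lt det fin; exists (zspace R C); split.
- exact: zspace_separable.
- exact: zspace_sigma_compact.
- exists (zmk C (fun=> 0)), (zset (zmk C (fun=> 0)) (0, 0)%N 1).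
  have r1 : ~ irrational (1 : R) by apply; exists 1; rewrite rmorph1.
  move=> /(congr1 (fun z => zval z (0, 0)%N)).
  rewrite (zmkE (zpoint0 R C)) zsetE ?lexx ?ler01 //; last by right.
  by rewrite eqxx => /esym/eqP; rewrite oner_eq0.
- have Zind := zspace_ind R Cirr rho_lt.
  have [[zeta|] Zz zle] := ind_eq_exists Zind.
    by exists zeta => // /fin; exact: ord_finite_le.
  have [/ind_le_None Z0 _] := Zz.
  by have : set0 (zmk C (fun=> 0) : zspace R C) by rewrite -Z0.
- move=> Y f _ clf ncf; apply: zspace_closed_images => //.
  exact: rank_no_infinite_clique rho_lt.
Qed.

(** * The graphs for finite and for infinite ordinals *)

Lemma countable_encoding (T : Type) (x0 : T) : countable [set: T] ->
  exists (i : T -> nat) (g : nat -> T), cancel i g.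
Proof.
move=> /countable_injP[i iinj]; exists i.
exists (fun n => if pselect (exists x, i x = n) is left e then projT1 (cid e) else x0) => x.
case: pselect => [e|[]]; last by exists x.
by apply: iinj; rewrite ?inE //; exact: projT2 (cid e).
Qed.

Lemma finite_alpha_witness (R : realType) (alpha : ordnum) (x0 : alpha) :
  ord_countable alpha -> ord_finite alpha ->
  exists (C : rel nat) (Th : ordnum) (rho : seq nat -> Th),
  [/\ symmetric C, irreflexive C,
    forall k s, pairwise C (k :: s) -> ~ ord_rel (rho s) (rho (k :: s)),
    detects_ind R C alpha & ord_finite (iseg (rho [::]))].
Proof.
move=> /(countable_encoding x0)[i [g gK]] fina.
have /finite_seqP[t tE] : finite_set (range i) by exact: finite_image.
have it x : i x \in t.
  by have ix : range i (i x) by [exists x]; rewrite tE in ix.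
(* Every number stands for an ordinal through [g]: this is the complete graph on [alpha] with
   vertices repeated. Repetitions are not joined, so a clique has at most [size t] vertices. *)
pose C k l := `[< g k <> g l >].
have CN u v : C u v -> i (g u) != i (g v).
  by move=> /asboolP guv; apply/eqP => /(can_inj gK).
pose rho (s : seq nat) : ord_nat := (size t - size s)%N.
exists C, ord_nat, rho; split.
- by move=> k l; apply/asboolP/asboolP => h /esym.
- by move=> k; apply/asboolP.
- move=> k s cks; rewrite /rho /ord_rel /= => le.
  have : (size [seq i (g m) | m <- k :: s] <= size t)%N.
    apply: uniq_leq_size; last by move=> _ /mapP[m _ ->].
    by rewrite uniq_pairwise pairwise_map; apply: sub_pairwise cks => u v; exact: CN.
  by rewrite size_map /=; lia.
- move=> Y A B K x AB Kx; pose s := undup t.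
  have st k : k \in s -> i (g k) = k.
    rewrite mem_undup => kt; have [y _ <-] : range i k by rewrite tE.
    by rewrite gK.
  exists s.
    have : pairwise (fun a b => a != b) s by rewrite -uniq_pairwise undup_uniq.
    apply: (sub_in_pairwise (P := mem s)); last exact/allP.
    move=> u v us vs uv; apply/asboolP => guv; move/eqP: uv; apply.
    by rewrite -(st u us) -(st v vs) guv.
  apply: (@inessential_off_reindex Y alpha nat i g A B setT).
  + by move=> k /= /st.
  + by move=> j _; rewrite gK /= mem_undup it.
  have AB' : closed_pairs (A \o i) (B \o i) by move=> j; exact: AB.
  apply: inessential_off_subset (inessential_below (x := x) (T := K) _ AB') => //.
    by move=> j _; exact: closed_pairs_separated.
  exists unit, (fun=> K); split=> [_|y Ky]; last by exists tt.
  by exists (Some (iseg x)) => //; exact: ord_le_refl.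
- exact: ord_nat_iseg_finite.
Qed.

Lemma infinite_alpha_witness (R : realType) (alpha : ordnum) (x0 : alpha) :
  ord_countable alpha ->
  exists (C : rel nat) (Th : ordnum) (rho : seq nat -> Th),
  [/\ symmetric C, irreflexive C,
    forall k s, pairwise C (k :: s) -> ~ ord_rel (rho s) (rho (k :: s)) &
    detects_ind R C alpha].
Proof.
move=> /(countable_encoding x0)[i0 [g0 g0K]].
have [i [g gK]] : exists (i : seq (alpha * nat) -> nat) (g : nat -> seq (alpha * nat)), cancel i g.
  exists (fun l => pickle [seq (i0 p.1, p.2) | p <- l]).
  exists (fun n => if @unpickle (seq (nat * nat)) n is Some l then [seq (g0 p.1, p.2) | p <- l] else [::]).
  move=> l; rewrite pickleK -map_comp -[RHS]map_id; apply: eq_map => -[y n] /=.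
  by rewrite g0K.
pose C k l := list_compatible (g k) (g l).
exists C, (ord_lex (ord_top (ord_lex alpha ord_nat)) ord_nat), (list_rank g); split.
- by move=> k l; apply/asboolP/asboolP => -[kl ck cl kls]; split=> //; [exact: nesym|tauto|exact: nesym|tauto].
- by move=> k; apply/asboolP => -[].
- by move=> k s; exact: list_rank_lt.
- move=> Y A B K x AB Kx.
  have AB' : closed_pairs (A \o i) (B \o i) by move=> j; exact: AB.
  have covK : ind_cover K (fun d => dim_le d (Some (iseg x))).
    exists unit, (fun=> K); split=> [_|y Ky]; last by exists tt.
    by exists (Some (iseg x)) => //; exact: ord_le_refl.
  have [w [pw _ iw]] := inessential_branch [::] covK AB'; rewrite cats0 in iw.
  (* The nodes of the branch are the nonempty suffixes of [w]. Of any two, one is a suffix of the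
     other, so their codes form a clique. *)
  have dropC m n : (m < n)%N -> (n < size w)%N -> list_compatible (drop m w) (drop n w).
    move=> mn nw; have pd d : pairwise (@lex_lt alpha) (drop d w).
      by move: pw; rewrite -{1}(cat_take_drop d w) pairwise_cat => /and3P[].
    apply/asboolP; split=> //.
      by move=> /(congr1 size); rewrite !size_drop; lia.
    right; exists (take (n - m) (drop m w)).
    by rewrite -{2}(subnK (ltnW mn)) -drop_drop cat_take_drop.
  exists [seq i (drop m w) | m <- iota 0 (size w)].
    have : pairwise ltn (iota 0 (size w)) by rewrite -(sorted_pairwise ltn_trans) iota_ltn_sorted.
    rewrite pairwise_map; apply: (sub_in_pairwise (P := fun m => (m < size w)%N)).
      by move=> m n _ nw mn; rewrite /C /= !gK; exact: dropC.
    by apply/allP => m; rewrite mem_iota.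
  apply: (@inessential_off_reindex Y _ nat i g A B _ _ _ _ _ _ iw).
  + move=> k /= /mapP[m]; rewrite mem_iota /= => mw ->; rewrite gK; split=> //; split.
      by exists (take m w); rewrite cat_take_drop.
    by rewrite size_drop subn_gt0.
  + move=> u /= [[t wE] u0]; rewrite gK; split=> //; apply/mapP; exists (size t).
      by rewrite mem_iota /= wE size_cat -[X in (X < _)%N]addn0 ltn_add2l.
    by rewrite wE drop_size_cat.
Qed.

Local Close Scope ring_scope.
Unset Implicit Arguments.

Theorem theorem1p2 (R : realType) (alpha : ordnum)
    (alpha_countable : ord_countable alpha)
    (alpha_ge2 : ord_le (ord_of_nat 2) alpha) :
  exists Z : metricType R,
    [/\ separable Z,
        sigma_compact Z,
        exists x y : Z, x <> y,
        exists2 zeta : ordnum, ind_eq Z (Some zeta)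
          & (ord_finite alpha -> ord_finite zeta)
      & forall (Y : metricType R) (f : Z -> Y),
          separable Y -> closed_mapping f -> non_constant f ->
          exists K : set Y,
            [/\ K `<=` range f, compact K
              & (exists2 d : option ordnum,
                   ind_eq (K : Type) d & dim_le (Some alpha) d)
                \/ ~ has_ind (K : Type)]].
Proof.
have [emb _] := alpha_ge2; pose x0 := emb ord0.
have [fina|infa] := pselect (ord_finite alpha).
  have [C [Th [rho [Csym Cirr rho_lt det fin]]]] := finite_alpha_witness R x0 alpha_countable fina.
  exact: (zspace_witness x0 Csym Cirr rho_lt det).
have [C [Th [rho [Csym Cirr rho_lt det]]]] := infinite_alpha_witness R x0 alpha_countable.
by apply: (zspace_witness x0 Csym Cirr rho_lt det) => /infa.
Qed.
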